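(* For every integer $\ell\ge 1$, $$|B_{SO(2\ell-1)}\backslash\mathcal{B}_{\mathfrak{so}(2\ell)}|=\sum_{k=1}^{\ell}2^{\ell-k}L(\ell,k)=\sum_{k=1}^{\ell}2^{\ell-k}\frac{\ell!}{k!}\binom{\ell-1}{k-1}.$$
   Context: Over $\mathbb{C}$: $SO(2\ell)$ is the group of determinant-one linear maps of $\mathbb{C}^{2\ell}$ preserving the symmetric bilinear form $\beta$ with $\beta(e_j,e_k)=\delta_{j,-k}$, where $e_1,\dots,e_\ell,e_{-\ell},\dots,e_{-1}$ is an ordered basis of $\mathbb{C}^{2\ell}$. $\mathcal{B}_{\mathfrak{so}(2\ell)}$ is the flag variety of $\mathfrak{so}(2\ell)$ (variety of Borel subalgebras). $SO(2\ell-1)\subset SO(2\ell)$ is the subgroup fixing $e_\ell-e_{-\ell}$, and $B_{SO(2\ell-1)}$ is the intersection of $SO(2\ell-1)$ with the group of upper triangular matrices with respect to the ordered basis above; it is a Borel subgroup of $SO(2\ell-1)$. $H\backslash X$ denotes the set of $H$-orbits on $X$. The Lah numbers are $L(\ell,k)=\frac{\ell!}{k!}\binom{\ell-1}{k-1}$ for $1\le k\le \ell$. *)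

(* Defs.v *)
From HB Require Import structures.
From mathcomp Require Import all_boot all_order all_algebra.
From mathcomp Require Import boolp classical_sets functions cardinality reals.
From mathcomp Require Import complex.

Set Implicit Arguments.
Unset Strict Implicit.
Unset Printing Implicit Defensive.

Import Order.TTheory GRing.Theory Num.Theory.

Local Open Scope classical_set_scope.
Local Open Scope ring_scope.

(* The ordered basis e_1, ..., e_l, e_{-l}, ..., e_{-1} of F^(2l) is the
   standard basis at the 0-based positions 0, ..., 2l-1: e_j sits at position
   j.-1, e_{-j} at position 2l - j, so the index change j |-> -j is rev_ord.
   Matrices act on column vectors on the left. *)

Section Orthogonal.
Variables (F : fieldType) (l : nat).
Local Notation V := 'cV[F]_(2 * l).
Local Notation M := 'M[F]_(2 * l).

Definition bform (u v : V) : F := \sum_(i < 2 * l) u i 0 * v (rev_ord i) 0.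

Definition SO : set M :=
  [set g | (forall u v : V, bform (g *m u) (g *m v) = bform u v)
           /\ \det g = 1].

Definition so : set M :=
  [set X | forall u v : V, bform (X *m u) v + bform u (X *m v) = 0].

(* e_l - e_{-l}: the entry 1 is at position l.-1 and the entry -1 at
   position l. *)
Definition fixed_vector : V :=
  \col_i ((i.+1 == l)%:R - ((i : nat) == l)%:R).

Definition SO_odd : set M :=
  [set g | SO g /\ g *m fixed_vector = fixed_vector].

Definition upper_triangular : set M :=
  [set g | forall i j : 'I_(2 * l), (j < i)%N -> g i j = 0].

Definition B_SO_odd : set M := SO_odd `&` upper_triangular.

End Orthogonal.

Section LieSubalgebras.
Variables (F : fieldType) (n : nat).
Local Notation M := 'M[F]_n.

Definition lie_bracket (X Y : M) : M := X *m Y - Y *m X.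

Definition lie_subalgebra (b : {vspace M}) : Prop :=
  forall X Y : M, X \in b -> Y \in b -> lie_bracket X Y \in b.

(* [b, b]; by bilinearity the brackets of basis elements suffice, see
   lie_derived_subP. *)
Definition lie_derived (b : {vspace M}) : {vspace M} :=
  <<[seq lie_bracket X Y | X <- vbasis b, Y <- vbasis b]>>%VS.

Lemma lie_derived_subP (b W : {vspace M}) :
  (lie_derived b <= W)%VS <->
  (forall X Y : M, X \in b -> Y \in b -> lie_bracket X Y \in W).
Proof.
split=> [/span_subvP sub X Y bX bY | sub].
  rewrite /lie_bracket (coord_vbasis bX) (coord_vbasis bY).
  rewrite mulmx_suml mulmx_sumr -sumrB; apply: rpred_sum => i _.
  rewrite mulmx_sumr mulmx_suml -sumrB; apply: rpred_sum => j _.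
  rewrite -!scalemxAl -!scalemxAr !scalerA [X in _ - X *: _]mulrC -scalerBr.
  apply: rpredZ; apply: sub; apply: allpairs_f;
    by apply: mem_nth; rewrite size_tuple.
apply/span_subvP => _ /allpairsP[[X Y] /= [bX bY ->]].
by apply: sub; apply: vbasis_mem.
Qed.

Definition lie_solvable (b : {vspace M}) : Prop :=
  exists k : nat, iter k lie_derived b = 0%VS.

Definition solvable_subalgebra (g : set M) (b : {vspace M}) : Prop :=
  [/\ forall X : M, X \in b -> g X, lie_subalgebra b & lie_solvable b].

Definition borel_subalgebras (g : set M) : set {vspace M} :=
  [set b | solvable_subalgebra g b /\
    forall b' : {vspace M}, solvable_subalgebra g b' -> (b <= b')%VS -> b' = b].

Definition Ad (g : M) (b : {vspace M}) : {vspace M} :=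
  (linfun (mulmxr (invmx g) \o mulmx g) @: b)%VS.

Lemma memv_Ad (g : M) (b : {vspace M}) (Y : M) :
  Y \in Ad g b <-> exists2 X : M, X \in b & Y = g *m X *m invmx g.
Proof.
split=> [/memv_imgP[X bX ->]|[X bX ->]]; first by exists X; rewrite ?lfunE.
by apply/memv_imgP; exists X; rewrite ?lfunE.
Qed.

Definition Ad_orbit (H : set M) (b : {vspace M}) : set {vspace M} :=
  [set Ad g b | g in H].

Definition orbit_set (H : set M) (X : set {vspace M}) : set (set {vspace M}) :=
  [set Ad_orbit H b | b in X].

End LieSubalgebras.

Definition flag_variety_so (F : fieldType) (l : nat) : set {vspace 'M[F]_(2 * l)} :=
  borel_subalgebras (@so F l).

(* The division is exact for 1 <= k <= l. *)
Definition lah (l k : nat) : nat := (l`! %/ k`! * 'C(l.-1, k.-1))%N.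

(* Main.v *)
(* Let n = 2l. By Lie's theorem a solvable subalgebra of so(n) stabilizes a full
   isotropic flag, so the Borel subalgebras are the Ad g b0 with g orthogonal and
   b0 the upper triangular part of so(n). By the Bruhat decomposition g = p s q,
   with p, q upper triangular orthogonal and s a permutation commuting with
   i |-> -i, such a subalgebra is Ad (p s) b0; its normalizer shows that s is
   unique up to exchanging the two middle positions. The group B_{SO(n-1)} is the
   stabilizer of e_l - e_{-l} among upper triangular orthogonal matrices, so for
   fixed s its orbits correspond to the orbits of the intersection of the
   upper triangular group with its conjugate by s on the vectors p^-1 (e_l - e_{-l}).
   Root subgroups and the torus bring such a vector to the form
   e_l - e_{-l} + sum_{i in A} e_i, where A + {l, -l} is an antichain for the
   pairs i < j with s(i) < s(j), and A is then an invariant of the orbit.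
   The antichain condition means that the elements of A carry a minus sign in s
   and that |s| is increasing on T = A + {l}. There are l!/|T|! permutations
   increasing on T, 2^(l-|T|) choices for the remaining signs (one being fixed by
   the middle exchange), and binomial(l-1, |T|-1) sets T. *)
From HB Require Import structures.
Require Import Defs.
From mathcomp Require Import all_boot all_order all_algebra.
From mathcomp Require Import boolp classical_sets functions cardinality reals.
From mathcomp Require Import fingroup perm complex spectral.
From mathcomp Require Import zify ring.

Set Implicit Arguments.
Unset Strict Implicit.
Unset Printing Implicit Defensive.

Import Order.TTheory GRing.Theory Num.Theory.
Local Open Scope classical_set_scope.
Local Open Scope ring_scope.

(** * Triangular matrices and the Bruhat decomposition *)

Section Triangular.
Variables (F : fieldType) (n : nat) (s : 'I_n -> nat).
Implicit Types A B : 'M[F]_n.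

(* s ranks the indices: A is upper triangular for this ranking, and vanishes on
   the first k diagonals. *)
Definition tri k A := forall i j, (s j < s i + k)%N -> A i j = 0.

Definition tri_trunc k A : 'M[F]_n :=
  \matrix_(i, j) if (s j < s i + k)%N then A i j else 0.

Lemma tri_trunc_is_linear k : linear (tri_trunc k).
Proof.
move=> a A B; apply/matrixP => i j; rewrite !mxE.
by case: ifP => _; rewrite ?mulr0 ?addr0.
Qed.

HB.instance Definition _ k :=
  GRing.isLinear.Build F 'M[F]_n 'M[F]_n _ (tri_trunc k) (tri_trunc_is_linear k).

Definition tri_space k : {vspace 'M[F]_n} := lker (linfun (tri_trunc k)).

Lemma mem_tri_space k A : A \in tri_space k <-> tri k A.
Proof.
rewrite memv_ker lfunE /=; split=> [/eqP/matrixP A0 i j ij | A0].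
  by have := A0 i j; rewrite !mxE ij.
by apply/eqP/matrixP => i j; rewrite !mxE; case: ifP => // /A0.
Qed.

Lemma triW k m A : (m <= k)%N -> tri k A -> tri m A.
Proof. by move=> mk tA i j ij; apply: tA; apply: leq_trans ij _; rewrite leq_add2l. Qed.

Lemma tri1 : tri 0 1%:M.
Proof.
by move=> i j; rewrite mxE addn0; case: eqP => // ->; rewrite ltnn.
Qed.

Lemma triD k A B : tri k A -> tri k B -> tri k (A + B).
Proof. by move=> tA tB i j ij; rewrite mxE tA ?tB ?addr0. Qed.

Lemma triZ k a A : tri k A -> tri k (a *: A).
Proof. by move=> tA i j ij; rewrite mxE tA ?mulr0. Qed.

Lemma triM k m A B : tri k A -> tri m B -> tri (k + m) (A *m B).
Proof.
move=> tA tB i j ij; rewrite mxE big1 // => a _.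
case: (ltnP (s a) (s i + k)) => ia; first by rewrite tA ?mul0r.
by rewrite tB ?mulr0 //; apply: leq_trans ij _; rewrite addnA leq_add2r.
Qed.

Lemma tri0M A B : tri 0 A -> tri 0 B -> tri 0 (A *m B).
Proof. exact: (@triM 0 0). Qed.

(* Left multiplication by A is an injective endomorphism of the space of
   triangular matrices, hence it reaches the identity there. *)
Lemma tri_inv A : A \in unitmx -> tri 0 A -> tri 0 (invmx A).
Proof.
move=> uA tA.
pose f := linfun (mulmx A : 'M[F]_n -> 'M[F]_n).
have sub : (f @: tri_space 0 <= tri_space 0)%VS.
  apply/subvP => _ /memv_imgP[B /mem_tri_space tB ->].
  by apply/mem_tri_space; rewrite lfunE /=; apply: (triM tA tB).
have kf : lker f = 0%VS.
  apply/eqP; rewrite -subv0; apply/subvP => B; rewrite memv_ker lfunE /= memv0.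
  by move=> /eqP AB; rewrite -(mulKmx uA B) AB mulmx0.
have fE : (f @: tri_space 0)%VS = tri_space 0.
  have dE : \dim (f @: tri_space 0) = \dim (tri_space 0).
    by apply: limg_dim_eq; rewrite kf capv0.
  by apply/eqP; rewrite eqEdim sub dE /=.
have /memv_imgP[B /mem_tri_space tB] : 1%:M \in (f @: tri_space 0)%VS.
  by rewrite fE; apply/mem_tri_space/tri1.
by rewrite lfunE /= => BA; rewrite -[invmx A]mulmx1 BA mulKmx.
Qed.

(** Both [A] and its inverse are triangular, so a diagonal entry of their product is the product of
    their diagonal entries. *)
Lemma tri_diag_neq0 A i : injective s -> A \in unitmx -> tri 0 A -> A i i != 0.
Proof.
move=> s_inj uA tA; apply/eqP => Aii0.
have /matrixP/(_ i i) := mulmxV uA.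
rewrite !mxE eqxx (bigD1 i) //= Aii0 mul0r add0r big1 => [/esym/eqP|k ki].
  by rewrite oner_eq0.
have [lt_ik|lt_ki|/s_inj eq_ik] := ltngtP (s i) (s k).
- by rewrite [X in _ * X](tri_inv uA tA) ?addn0 // mulr0.
- by rewrite tA ?addn0 // mul0r.
- by rewrite eq_ik eqxx in ki.
Qed.

End Triangular.

Notation upper := (tri (@nat_of_ord _) 0).

Lemma upper_triangularE (F : fieldType) l (g : 'M[F]_(2 * l)) :
  upper_triangular g <-> upper g.
Proof. by split=> ug i j ij; apply: ug; rewrite ?addn0 // in ij *. Qed.

Lemma perm_conjE (F : fieldType) n (s : {perm 'I_n}) (A : 'M[F]_n) i j :
  (perm_mx s *m A *m perm_mx s^-1) i j = A (s i) (s j).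
Proof. by rewrite -row_permE -col_permE !mxE. Qed.

Section Bruhat.
Variables (F : fieldType) (n : nat).

Lemma perm_conjVE (s : {perm 'I_n}) (A : 'M[F]_n) i j :
  (perm_mx s^-1 *m A *m perm_mx s) i j = A (s^-1%g i) (s^-1%g j).
Proof. by rewrite -perm_conjE invgK. Qed.

Lemma tri_perm_conj (s : {perm 'I_n}) (A : 'M[F]_n) :
  tri (fun i => s i) 0 A <-> upper (perm_mx s^-1 *m A *m perm_mx s).
Proof.
split=> tA i j; rewrite ?addn0 => ij.
  by rewrite perm_conjVE tA // addn0 !permKV.
by have := tA (s i) (s j); rewrite perm_conjVE !permK addn0; apply.
Qed.

(** If [s i < i], strong induction makes [s i] a fixed point, and injectivity gives [s i = i]. *)
Lemma perm_of_le (s : {perm 'I_n}) : (forall i, (s i <= i)%N) -> s = 1%g.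
Proof.
move=> sle; apply/permP => i; rewrite perm1; apply/eqP.
elim/ltn_ind: {i}(i : nat) {-2}i (erefl (i : nat)) => m IH i im.
rewrite -(inj_eq val_inj) eqn_leq sle leqNgt /=; apply/negP => lt_si.
have := IH _ _ (s i) erefl; rewrite -im lt_si => /(_ isT).
by rewrite (inj_eq perm_inj) => /eqP E; rewrite E ltnn in lt_si.
Qed.

(** The diagonal entry of [p = t q s^-1] at [s^-1 j] is the entry of [q] in row [t (s^-1 j)] and
    column [j]. It is nonzero, so [t (s^-1 j) <= j] for every [j], which forces [s = t]. *)
Lemma bruhat_uniq (s t : {perm 'I_n}) (p q : 'M[F]_n) :
  p \in unitmx -> upper p -> upper q ->
  p *m perm_mx s = perm_mx t *m q -> s = t.
Proof.
move=> up tp tq E.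
apply/esym/eqP; rewrite eq_mulVg1; apply/eqP.
suff : (s^-1 * t)%g = 1%g by move/(congr1 (fun x => x^-1)%g); rewrite invMg invgK invg1.
apply: perm_of_le => j; rewrite leqNgt; apply/negP => lt_j.
have : p (s^-1 j)%g (s^-1 j)%g != 0 by apply: tri_diag_neq0 up tp; apply: val_inj.
have -> : p = perm_mx t *m q *m perm_mx s^-1.
  by rewrite -E -mulmxA -perm_mxM mulgV perm_mx1 mulmx1.
rewrite -mulmxA -row_permE mxE -col_permE mxE permKV.
by rewrite tq ?eqxx // addn0 -permM.
Qed.

(* Row i of x *m g, with x upper unitriangular, can be given a maximal number
   of leading zeros; by maximality these numbers are pairwise distinct. *)
Lemma bruhat_exists (g : 'M[F]_n) : g \in unitmx ->
  exists p q : 'M[F]_n, exists s : {perm 'I_n},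
    [/\ p \in unitmx, upper p, upper q & g = p *m perm_mx s *m q].
Proof.
move=> ug.
pose lead (i : 'I_n) (x : 'rV[F]_n) (k : nat) :=
  [/\ x 0 i = 1, forall j : 'I_n, (j < i)%N -> x 0 j = 0 &
      forall j : 'I_n, (j < k)%N -> (x *m g) 0 j = 0].
have lead_lt i x k : lead i x k -> (k < n)%N.
  case=> xi _ xg; rewrite ltnNge; apply/negP => nk.
  have x0 : x *m g = 0.
    apply/matrixP => a j; rewrite ord1 [RHS]mxE xg //.
    by apply: leq_trans (ltn_ord j) nk.
  by move: xi; rewrite -(mulmxK ug x) x0 mul0mx mxE => /eqP; rewrite eq_sym oner_eq0.
have maxlead i : exists xk : 'rV[F]_n * 'I_n, lead i xk.1 xk.2 /\
    forall y m, lead i y m -> (m <= xk.2)%N.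
  have exP : exists k, `[< exists x, lead i x k >].
    exists 0%N; apply/asboolP; exists (delta_mx 0 i).
    split=> [|j ji|//]; rewrite mxE eqxx ?eqxx //=.
    by rewrite -(inj_eq val_inj) /= (ltn_eqF ji).
  have ubP k : `[< exists x, lead i x k >] -> (k <= n)%N.
    by move=> /asboolP[x /lead_lt /ltnW].
  case: (ex_maxnP exP ubP) => k /asboolP[x xk] kmax.
  exists (x, Ordinal (lead_lt _ _ _ xk)); split=> // y m ym.
  by apply: kmax; apply/asboolP; exists y.
have [f fP] := choice maxlead.
pose x : 'M[F]_n := \matrix_(i, j) (f i).1 0 j.
pose sg i := (f i).2.
have rx i : row i x = (f i).1 by apply/rowP => j; rewrite !mxE.
have xgE i j : (x *m g) i j = ((f i).1 *m g) 0 j.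
  by rewrite -rx -row_mul [RHS]mxE.
have xg0 (i j : 'I_n) : (j < sg i)%N -> (x *m g) i j = 0.
  by move=> ji; rewrite xgE; case: (fP i) => [[_ _ ->]].
have xgn i : (x *m g) i (sg i) != 0.
  apply/eqP => xg0i; case: (fP i) => [[fi fl fz] fmax].
  suff : lead i (f i).1 (sg i).+1 by move/fmax; rewrite ltnn.
  split=> // j; rewrite ltnS leq_eqVlt => /orP[/eqP/val_inj-> |]; last exact: fz.
  by rewrite -xgE.
have tx : upper x.
  by move=> i j; rewrite addn0 mxE; case: (fP i) => [[_ + _] _]; apply.
have ux : x \in unitmx.
  rewrite unitmxE -det_tr det_trig; last first.
    by apply/is_trig_mxP => i j ij; rewrite mxE tx ?addn0.
  rewrite big1 ?unitr1 // => i _; rewrite !mxE; by case: (fP i) => [[-> _ _] _].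
have sg_lt (i k : 'I_n) : (i < k)%N -> sg i != sg k.
  move=> ik; apply/eqP => E.
  (* This multiple of row [k] cancels the leading entry of row [i]. As [i < k], subtracting it keeps
     the unitriangular shape and produces one more leading zero, against maximality. *)
  pose c := (x *m g) i (sg i) / (x *m g) k (sg k).
  case: (fP i) => [[fi fl fz] fmax]; case: (fP k) => [[ki kl kz] _].
  suff : lead i ((f i).1 - c *: (f k).1) (sg i).+1 by move/fmax; rewrite ltnn.
  split.
  - by rewrite !mxE fi kl // mulr0 subr0.
  - by move=> j ji; rewrite !mxE fl // kl ?mulr0 ?subr0 // (ltn_trans ji).
  move=> j; have -> : (((f i).1 - c *: (f k).1) *m g) 0 j = (x *m g) i j - c * (x *m g) k j.
    rewrite mulmxBl -scalemxAl !xgE mxE; congr (_ + _).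
    by rewrite mxE; congr (- _); rewrite mxE.
  rewrite ltnS leq_eqVlt => /orP[/eqP/val_inj-> |ji].
    by rewrite /c -E divfK ?subrr // E.
  by rewrite !xg0 ?mulr0 ?subr0 // -E.
have sg_inj : injective sg.
  move=> i k E; case: (ltngtP i k) => [/sg_lt|/sg_lt|/val_inj//].
    by move/eqP.
  by move/eqP; case.
pose s := perm sg_inj.
(* Row [i] of [x *m g] starts with [sg i] zeros, so sorting the rows by [s] makes the matrix upper
   triangular. *)
exists (invmx x), (perm_mx s^-1 *m (x *m g)), s; split.
- by rewrite unitmx_inv.
- exact: tri_inv.
- move=> i j; rewrite addn0 -row_permE mxE => ji; apply: xg0.
  by rewrite -[sg _](permE sg_inj) permKV.
- by rewrite -mulmxA [X in _ *m X]mulmxA -perm_mxM mulgV perm_mx1 mul1mx mulKmx.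
Qed.

End Bruhat.

(** * Orthogonal Bruhat decomposition *)

Section SquareRoot.
Variable C : numClosedFieldType.

(** Root by root, as in Hensel's lemma: if [f] works for the product [m], then [f + c m] works for
    [(X - a) m] with a suitable constant [c]. *)
Lemma sqrt_modp (rs : seq C) : all (fun a => a != 0) rs ->
  exists f : {poly C}, \prod_(a <- rs) ('X - a%:P) %| f ^+ 2 - 'X.
Proof.
elim: rs => [_|a rs IH /= /andP[a0 /IH[f]]].
  by exists 0; rewrite big_nil dvd1p.
rewrite big_cons; set m := \prod_(b <- rs) _ => /dvdpP[h hE].
(* If [m(a) = 0], then [f(a)^2 = a] is nonzero and [c] solves [h(a) + 2 c f(a) = 0]. Otherwise [c]
   makes the value of [f + c m] at [a] a square root of [a]. *)
pose c := if m.[a] == 0 then - h.[a] / (f.[a] *+ 2)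
          else (sqrtC a - f.[a]) / m.[a].
exists (f + c%:P * m).
have -> : (f + c%:P * m) ^+ 2 - 'X
    = (h + c%:P * f *+ 2 + c%:P ^+ 2 * m) * m.
  transitivity (f ^+ 2 - 'X + (c%:P * f *+ 2 + c%:P ^+ 2 * m) * m); first by ring.
  by rewrite hE; ring.
rewrite dvdp_mul // dvdp_XsubCl rootE.
have eqa : (h * m).[a] = f.[a] ^+ 2 - a.
  by rewrite -hE !hornerE.
have -> : (h + c%:P * f *+ 2 + c%:P ^+ 2 * m).[a]
    = h.[a] + c * (f.[a] *+ 2) + c ^+ 2 * m.[a] by rewrite !(hornerD, hornerM, hornerMn, hornerC, horner_exp); ring.
rewrite hornerE in eqa.
have [ma0|ma0] := eqVneq m.[a] 0.
  rewrite /c ma0 eqxx mulr0 addr0.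
  have fa0 : f.[a] *+ 2 != 0.
    rewrite mulrn_eq0 /=; apply: contra_neq a0 => fa0.
    by move: eqa; rewrite ma0 mulr0 fa0 expr0n /= sub0r => /eqP; rewrite eq_sym oppr_eq0 => /eqP.
  by rewrite divfK // subrr.
rewrite -(inj_eq (mulIf ma0)) mul0r.
rewrite !mulrDl eqa /c (negPf ma0).
set x := (_ - _) / _.
have xm : x * m.[a] = sqrtC a - f.[a] by rewrite divfK.
have -> : x * (f.[a] *+ 2) * m.[a] = (sqrtC a - f.[a]) * (f.[a] *+ 2).
  by rewrite mulrAC xm.
have -> : x ^+ 2 * m.[a] * m.[a] = (sqrtC a - f.[a]) ^+ 2.
  by rewrite -xm; ring.
by rewrite -{2}(sqrtCK a); apply/eqP; ring.
Qed.

(* The closure property expresses that y is a polynomial in z. *)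
Lemma sqrt_mx n (z : 'M[C]_n) : z \in unitmx -> exists2 y, y *m y = z &
  forall P : 'M[C]_n -> Prop, P 1%:M ->
    (forall A B, P A -> P B -> P (A + B)) ->
    (forall a A, P A -> P (a *: A)) -> (forall A, P A -> P (A *m z)) -> P y.
Proof.
case: n z => [z _ | n z uz].
  exists z => [|P P1 _ _ _]; first by apply/matrixP; case.
  by have -> : z = 1%:M by apply/matrixP; case.
have [rs rsE] := closed_field_poly_normal (char_poly z).
have lc1 : lead_coef (char_poly z) = 1 by apply/eqP/char_poly_monic.
rewrite lc1 scale1r in rsE.
have rs0 : all (fun a => a != 0) rs.
  apply/allP => a ars; apply/eqP => a0; rewrite {a}a0 in ars.
  have : root (char_poly z) 0 by rewrite rsE root_prod_XsubC.
  rewrite rootE horner_coef0 char_poly_det mulf_eq0 signr_eq0 /=.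
  by move: uz; rewrite unitmxE unitfE => /negPf->.
have [f /dvdpP[h hE]] := sqrt_modp rs0.
exists (horner_mx z f).
  apply/eqP; rewrite -subr_eq0 -[X in _ - X]horner_mx_X -[_ *m _]/(_ * _).
  by rewrite -expr2 -rmorphXn -rmorphB hE -rsE rmorphM /= Cayley_Hamilton mulr0.
move=> P P1 PD PZ PM; elim/poly_ind: f {h hE} => [|f a Pf].
  by rewrite rmorph0 -[0](scale0r 1%:M); apply: PZ.
rewrite rmorphD rmorphM /= horner_mx_X horner_mx_C -scalemx1.
by apply: PD; [apply: PM | apply: PZ].
Qed.

End SquareRoot.

(** * The adjoint for the symmetric form, and orthogonal matrices *)

Section Adjoint.
Variable F : fieldType.

Definition rev_mx n : 'M[F]_n := perm_mx (perm (@rev_ord_inj n)).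

Lemma rev_permE n i : perm (@rev_ord_inj n) i = rev_ord i.
Proof. exact: permE. Qed.

Lemma rev_permV n : ((perm (@rev_ord_inj n))^-1 = perm (@rev_ord_inj n))%g.
Proof.
by apply/permP => i; apply: (@perm_inj _ (perm (@rev_ord_inj n))); rewrite permKV !permE rev_ordK.
Qed.

Lemma tr_rev_mx n : (rev_mx n)^T = rev_mx n.
Proof. by rewrite tr_perm_mx rev_permV. Qed.

Lemma rev_mxK n : rev_mx n *m rev_mx n = 1%:M.
Proof. by rewrite -perm_mxM -{1}rev_permV mulVg perm_mx1. Qed.

(* The adjoint with respect to bform, for rectangular matrices; locked so that
   rewriting with mulmxA does not see the product inside. *)
Definition adj m n (A : 'M[F]_(m, n)) : 'M[F]_(n, m) :=
  locked (rev_mx n *m A^T *m rev_mx m).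

Lemma adj_def m n (A : 'M[F]_(m, n)) : adj A = rev_mx n *m A^T *m rev_mx m.
Proof. by rewrite /adj -lock. Qed.

Lemma adjE m n (A : 'M[F]_(m, n)) i j : adj A i j = A (rev_ord j) (rev_ord i).
Proof.
by rewrite adj_def -row_permE /rev_mx -[X in _ *m perm_mx X]rev_permV -col_permE !mxE !permE.
Qed.

Lemma adjM m n p (A : 'M[F]_(m, n)) (B : 'M[F]_(n, p)) :
  adj (A *m B) = adj B *m adj A.
Proof.
rewrite !adj_def trmx_mul !mulmxA; congr (_ *m _).
by rewrite -!mulmxA; do 2 congr (_ *m _); rewrite mulmxA rev_mxK mul1mx.
Qed.

Lemma adjK m n (A : 'M[F]_(m, n)) : adj (adj A) = A.
Proof. by apply/matrixP => i j; rewrite !adjE !rev_ordK. Qed.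

Lemma adj_is_linear m n : linear (@adj m n).
Proof. by move=> a A B; rewrite !adj_def linearP /= mulmxDr mulmxDl -scalemxAr -scalemxAl. Qed.

HB.instance Definition _ m n :=
  GRing.isLinear.Build F 'M[F]_(m, n) 'M[F]_(n, m) _ (@adj m n) (@adj_is_linear m n).

Lemma adj1 n : adj 1%:M = 1%:M :> 'M[F]_n.
Proof. by rewrite adj_def trmx1 mulmx1 rev_mxK. Qed.

Lemma adj_unit n (A : 'M[F]_n) : (adj A \in unitmx) = (A \in unitmx).
Proof. by rewrite adj_def !unitmx_mul unitmx_tr !unitmx_perm andbT. Qed.

Lemma adjV n (A : 'M[F]_n) : adj (invmx A) = invmx (adj A).
Proof.
have [uA|nA] := boolP (A \in unitmx).
  apply: (can_inj (mulKmx (etrans (adj_unit A) uA))).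
  by rewrite -adjM mulVmx // adj1 mulmxV // adj_unit.
by rewrite !invmx_out // inE adj_unit.
Qed.

Lemma upper_adj n (A : 'M[F]_n) : upper A -> upper (adj A).
Proof.
move=> uA i j; rewrite addn0 => ij; rewrite adjE uA // addn0 /=.
by have := ltn_ord i; have := ltn_ord j; lia.
Qed.

Definition orth n (g : 'M[F]_n) := adj g *m g = 1%:M.

Lemma orth_unit n (g : 'M[F]_n) : orth g -> g \in unitmx.
Proof. by case/mulmx1_unit. Qed.

Lemma orth_inv n (g : 'M[F]_n) : orth g -> invmx g = adj g.
Proof. by move=> og; rewrite -[adj g](mulmxK (orth_unit og)) og mul1mx. Qed.

Lemma orthC n (g : 'M[F]_n) : orth g -> g *m adj g = 1%:M.
Proof. by move=> og; rewrite -(orth_inv og) mulmxV // orth_unit. Qed.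

Lemma orth_adj n (g : 'M[F]_n) : orth g -> orth (adj g).
Proof. by move=> og; rewrite /orth adjK orthC. Qed.

Lemma orthM n (g h : 'M[F]_n) : orth g -> orth h -> orth (g *m h).
Proof.
by move=> og oh; rewrite /orth adjM mulmxA -[adj h *m _ *m _]mulmxA og mulmx1.
Qed.

Definition rev_comm n (s : {perm 'I_n}) := forall i, s (rev_ord i) = rev_ord (s i).

Lemma rev_commV n (s : {perm 'I_n}) : rev_comm s -> rev_comm s^-1.
Proof. by move=> rs i; apply: (@perm_inj _ s); rewrite rs !permKV. Qed.

Lemma orth_perm n (s : {perm 'I_n}) : rev_comm s -> orth (perm_mx s).
Proof.
move=> rs; rewrite /orth adj_def tr_perm_mx -!perm_mxM.
suff -> : (perm (@rev_ord_inj n) * s^-1 * perm (@rev_ord_inj n) * s)%g = 1%g by rewrite perm_mx1.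
by apply/permP => i; rewrite !permM !rev_permE (rev_commV rs) rev_ordK permKV perm1.
Qed.

Lemma adj_perm n (s : {perm 'I_n}) : rev_comm s -> adj (perm_mx s) = perm_mx s^-1.
Proof.
move=> rs; rewrite -[LHS]mulmx1 -(perm_mx1 F) -(mulgV s) perm_mxM mulmxA.
by rewrite orth_perm // mul1mx.
Qed.

End Adjoint.

Section OrthogonalBruhat.
Variables (C : numClosedFieldType) (n : nat).

(* Both p s q and its image under g |-> (adj g)^-1 are Bruhat decompositions of
   g, so s commutes with rev_ord; p is then corrected by a square root of
   (adj p p)^-1. *)
Lemma orth_bruhat (g : 'M[C]_n) : orth g -> exists p q : 'M[C]_n, exists s : {perm 'I_n},
  [/\ orth p /\ upper p, orth q /\ upper q, rev_comm s & g = p *m perm_mx s *m q].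
Proof.
move=> og; have ug := orth_unit og.
have [p [q [s [up tp tq gE]]]] := bruhat_exists ug.
have uq : q \in unitmx by move: ug; rewrite gE !unitmx_mul => /andP[].
pose r := perm (@rev_ord_inj n).
pose P := invmx (adj p); pose Q := invmx (adj q).
have tP : upper P by apply: tri_inv; rewrite ?adj_unit //; apply: upper_adj.
have tQ : upper Q by apply: tri_inv; rewrite ?adj_unit //; apply: upper_adj.
have uP : P \in unitmx by rewrite unitmx_inv adj_unit.
have uQ : Q \in unitmx by rewrite unitmx_inv adj_unit.
have gE2 : g = P *m perm_mx (r * s * r)%g *m Q.
  apply: (can_inj (mulKmx (etrans (adj_unit g) ug))).
  rewrite og gE !adjM [adj (perm_mx s)]adj_def tr_perm_mx -/(rev_mx _ n) !perm_mxM.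
  rewrite -/(rev_mx _ n).
  have -> : adj q *m (rev_mx C n *m perm_mx s^-1 *m rev_mx C n *m adj p) *m
      (P *m (rev_mx C n *m perm_mx s *m rev_mx C n) *m Q) =
    adj q *m (rev_mx C n *m (perm_mx s^-1 *m (rev_mx C n *m (adj p *m P)
       *m rev_mx C n) *m perm_mx s) *m rev_mx C n) *m Q by rewrite !mulmxA.
  rewrite mulmxV ?adj_unit // mulmx1 rev_mxK mulmx1 -perm_mxM mulVg perm_mx1 mulmx1.
  by rewrite rev_mxK mulmx1 mulmxV // adj_unit.
have srs : s = (r * s * r)%g.
  apply: (@bruhat_uniq _ _ _ _ (invmx P *m p) (Q *m invmx q)).
  - by rewrite unitmx_mul unitmx_inv uP.
  - by apply: tri0M tp; apply: tri_inv.
  - by apply: tri0M tQ _; apply: tri_inv.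
  - rewrite -mulmxA -(mulmxK uq (p *m _)) -gE gE2.
    by rewrite !mulmxA mulVmx // mul1mx.
have rs : rev_comm s.
  by move=> i; rewrite {1}srs !permM !rev_permE rev_ordK.
rewrite -srs in gE2.
pose z := invmx (adj p *m p).
have uz : z \in unitmx by rewrite unitmx_inv unitmx_mul adj_unit up.
have adjz : adj z = z by rewrite /z adjV adjM adjK.
have zE : z = invmx p *m P.
  have upp : adj p *m p \in unitmx by rewrite unitmx_mul adj_unit up.
  have E : adj p *m p *m (invmx p *m P) = 1%:M.
    by rewrite mulmxA mulmxK // mulmxV // adj_unit.
  by rewrite -[RHS](mulKmx upp) E mulmx1.
have tz : upper z by rewrite zE; apply: tri0M tP; apply: tri_inv.
have sz : tri (fun i => s i) 0 z.
  apply/tri_perm_conj; have -> : perm_mx s^-1 *m z *m perm_mx s = q *m invmx Q.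
    rewrite zE -(mulmxK uQ (perm_mx s^-1 *m _ *m _)); congr (_ *m _).
    rewrite -!mulmxA [P *m _]mulmxA -gE2 gE -!mulmxA mulKmx // mulmxA.
    by rewrite -perm_mxM mulVg perm_mx1 mul1mx.
  by apply: tri0M tq _; apply: tri_inv.
have [y yz yP] := sqrt_mx uz.
(* As a polynomial in [z], [y] is triangular for both rankings, self-adjoint and commutes with [z].
   Hence [p *m y] is orthogonal, and the inverse of [y] can be moved across [s] without leaving the
   upper triangular matrices. *)
have ty : upper y.
  apply: yP; [exact: tri1 | exact: triD | exact: triZ | move=> A tA].
  exact: tri0M tA tz.
have sy : tri (fun i => s i) 0 y.
  apply: yP; [exact: tri1 | exact: triD | exact: triZ | move=> A tA].
  exact: tri0M tA sz.
have [adjy zy] : adj y = y /\ z *m y = y *m z.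
  apply: (yP (fun A => adj A = A /\ z *m A = A *m z)).
  - by rewrite adj1 mulmx1 mul1mx.
  - by move=> A B [aA cA] [aB cB]; rewrite linearD /= aA aB mulmxDl mulmxDr cA cB.
  - by move=> a A [aA cA]; rewrite linearZ /= aA -scalemxAl -scalemxAr cA.
  - by move=> A [aA cA]; rewrite adjM adjz aA cA !mulmxA cA.
have uy : y \in unitmx by move: uz; rewrite -yz unitmx_mul => /andP[].
have op : orth (p *m y).
  have zV : adj p *m p = invmx z by rewrite invmxK.
  rewrite /orth; have -> : adj (p *m y) *m (p *m y) = y *m invmx z *m y.
    by rewrite adjM adjy -zV !mulmxA.
  by apply: (can_inj (mulmxK uz)); rewrite mul1mx -[LHS]mulmxA -zy mulmxA mulmxKV.
exists (p *m y), (perm_mx s^-1 *m invmx y *m perm_mx s *m q), s.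
have uw : invmx (p *m y) *m g = invmx y *m perm_mx s *m q.
  have -> : g = (p *m y) *m (invmx y *m perm_mx s *m q) by rewrite gE !mulmxA mulmxK.
  by rewrite mulKmx // orth_unit.
split=> //.
- by split=> //; apply: tri0M tp ty.
- split; last first.
    apply: tri0M tq; apply/tri_perm_conj; exact: tri_inv.
  have -> : perm_mx s^-1 *m invmx y *m perm_mx s *m q = adj (perm_mx s) *m adj (p *m y) *m g.
    by rewrite adj_perm // -(orth_inv op) -[RHS]mulmxA uw !mulmxA.
  by apply: orthM og; apply: orthM; apply: orth_adj => //; apply: orth_perm.
rewrite gE -!mulmxA; congr (_ *m _); rewrite [perm_mx s *m (_ *m _)]mulmxA -perm_mxM.
by rewrite mulgV perm_mx1 mul1mx mulKVmx.
Qed.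

End OrthogonalBruhat.

(** * Lie's theorem *)

Section WeightInvariance.
Variables (C : numClosedFieldType) (m : nat) (T : Type) (a : T -> Prop).
Variables (rho : T -> 'M[C]_m) (br : T -> T) (lam : T -> C) (Y : 'M[C]_m).
Variable w : 'rV[C]_m.
Hypothesis brP : forall X, a X ->
  a (br X) /\ rho (br X) = rho X *m Y - Y *m rho X.
Hypothesis w_neq0 : w != 0.
Hypothesis w_lam : forall X, a X -> w *m rho X = lam X *: w.

Let wY d := iter d (mulmxr Y) w.
Let K d : 'M[C]_m := (\sum_(i < d) <<wY i>>)%MS.
Let D X := rho X - (lam X)%:M.

Let KS d : (K d.+1 :=: K d + wY d)%MS.
Proof. by rewrite /K big_ord_recr /=; apply: adds_eqmx => //; apply: genmxE. Qed.

Let wYK i d : (i < d)%N -> (wY i <= K d)%MS.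
Proof. by move=> id; rewrite (sumsmx_sup (Ordinal id)) //= genmxE. Qed.

Let K_sub (B A : 'M[C]_m) d : (forall i, (i < d)%N -> (wY i *m B <= A)%MS) ->
  (K d *m B <= A)%MS.
Proof.
move=> KB; rewrite sumsmxMr; apply/sumsmx_subP => i _.
by rewrite (eqmxMr _ (genmxE _)); apply: KB.
Qed.

Let KW i d : (i <= d)%N -> (K i <= K d)%MS.
Proof.
move=> id; rewrite -[K i]mulmx1; apply: K_sub => j ji; rewrite mulmx1.
by apply: wYK; apply: leq_trans ji id.
Qed.

Let KY d : (K d *m Y <= K d.+1)%MS.
Proof. by apply: K_sub => i id; apply: (wYK (i := i.+1)). Qed.

Let YD X : a X -> Y *m D X = D X *m Y - rho (br X).
Proof.
move=> aX; have [_ ->] := brP aX.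
rewrite /D mulmxBl mulmxBr mul_mx_scalar mul_scalar_mx.
by rewrite opprB [RHS]addrC addrA subrK.
Qed.

(** Induction on [d]: moving [Y] past [D X] by [YD] costs one [lam (br X)] each time. So [D X]
    lowers the filtration by the Krylov spaces [K d], with [-(d+1) lam (br X)] as coefficient. *)
Let wYD d X : a X ->
  ((wY d.+1 *m D X + (d.+1%:R * lam (br X)) *: wY d)%R <= K d)%MS.
Proof.
have w0 Z : a Z -> w *m D Z = 0.
  by move=> aZ; rewrite mulmxBr w_lam // mul_mx_scalar subrr.
have rhoE Z d' : wY d' *m rho Z = wY d' *m D Z + lam Z *: wY d'.
  by rewrite /D mulmxBr mul_mx_scalar subrK.
elim: d X => [|d IH] X aX.
  rewrite /= -mulmxA YD // mulmxBr mulmxA w0 // mul0mx.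
  by rewrite (w_lam (brP aX).1) mul1r sub0r addNr sub0mx.
have abX := (brP aX).1.
have -> : wY d.+2 *m D X + (d.+2%:R * lam (br X)) *: wY d.+1 =
  (wY d.+1 *m D X + (d.+1%:R * lam (br X)) *: wY d) *m Y - wY d.+1 *m D (br X).
  rewrite [wY d.+2]/(wY d.+1 *m Y) -mulmxA YD // mulmxBr rhoE mulmxDl mulmxA.
  rewrite -[_ *: wY d *m Y]scalemxAl -[wY d *m Y]/(wY d.+1).
  rewrite -[d.+2]addn1 natrD mulrDl mul1r scalerDl opprD.
  by rewrite addrACA subrK.
apply: addmx_sub; first by apply: submx_trans (submxMr _ (IH _ aX)) (KY d).
rewrite eqmx_opp -[_ *m _](addrK ((d.+1%:R * lam (br (br X))) *: wY d)).
apply: addmx_sub; first by apply: submx_trans (IH _ abX) (KW _).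
by rewrite eqmx_opp scalemx_sub // wYK.
Qed.

(* If lam (br X) were nonzero, the vectors w Y^d would be independent. *)
Lemma weight_bracket0 X : a X -> lam (br X) = 0.
Proof.
move=> aX; apply/eqP/negPn/negP => mu0.
have w0 : w *m D X = 0 by rewrite mulmxBr w_lam // mul_mx_scalar subrr.
have KD d : (K d.+1 *m D X <= K d)%MS.
  apply: K_sub => -[_|i]; first by rewrite /= w0 sub0mx.
  rewrite ltnS => id; rewrite -[_ *m _](addrK ((i.+1%:R * lam (br X)) *: wY i)).
  apply: addmx_sub; first by apply: submx_trans (wYD _ aX) (KW (ltnW id)).
  by rewrite eqmx_opp scalemx_sub // wYK.
(* If [wY d.+1] were in [K d.+1], then [D X] would send it into [K d], and [wYD] would put a nonzero
   multiple of [wY d] into [K d]; characteristic zero is used here. *)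
have indep d : ~~ (wY d <= K d)%MS.
  elim: d => [|d IH]; first by rewrite /K big_ord0 submx0.
  apply: contra IH => wK.
  have c0 : d.+1%:R * lam (br X) != 0 by rewrite mulf_neq0 // pnatr_eq0.
  rewrite -(eqmx_scale _ c0).
  rewrite -[X in (X <= _)%MS](addKr (wY d.+1 *m D X)).
  apply: addmx_sub; last exact: wYD.
  by rewrite eqmx_opp; apply: submx_trans (submxMr _ wK) (KD d).
have rkK d : (d <= \rank (K d))%N.
  elim: d => // d IH; apply: leq_ltn_trans IH _; apply: rank_ltmx.
  rewrite /ltmx KW //=; apply: contra (indep d) => KK.
  by apply: submx_trans KK; apply: wYK.
by have := leq_trans (rkK m.+1) (rank_leq_col _); rewrite ltnn.
Qed.

End WeightInvariance.

Section LieTheorem.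
Variables (C : numClosedFieldType) (n m : nat).
Variable rho : {linear 'M[C]_n -> 'M[C]_m}.
Implicit Types b : {vspace 'M[C]_n}.

Lemma lie_derivedP b X Y : X \in b -> Y \in b -> lie_bracket X Y \in lie_derived b.
Proof. by move: X Y; apply/lie_derived_subP. Qed.

Lemma lie_derived_sub b : lie_subalgebra b -> (lie_derived b <= b)%VS.
Proof. by move=> lb; apply/lie_derived_subP. Qed.

(** Induction on the derived length. The derived algebra has a common eigenvector, and its weight
    space [W] is stable under [b] by [weight_bracket0]. On [W] a commutator acts by a scalar of
    trace zero, hence by zero, so [b] acts by commuting matrices, which have a common eigenvector.
    Compatibility with brackets is asked on [b] only, since the compression to a subquotient
    respects brackets just for matrices that stabilize the subspaces. *)
Lemma lie_theorem k b : (0 < m)%N ->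
  (forall X Y, X \in b -> Y \in b ->
     rho (lie_bracket X Y) = lie_bracket (rho X) (rho Y)) ->
  lie_subalgebra b -> iter k (@lie_derived C n) b = 0%VS ->
  exists2 v : 'rV[C]_m, v != 0 & forall X, X \in b -> (v *m rho X <= v)%MS.
Proof.
move=> m_gt0; elim: k b => [|k IH] b rhoM lb.
  move=> /= ->; exists (const_mx 1).
    apply/eqP => /rowP/(_ (Ordinal m_gt0)); rewrite !mxE => /eqP.
    by rewrite oner_eq0.
  by move=> X; rewrite memv0 => /eqP->; rewrite linear0 mulmx0 sub0mx.
rewrite iterSr => bk; set b1 := lie_derived b in bk.
have b1b : (b1 <= b)%VS by apply: lie_derived_sub.
have inb X : X \in b1 -> X \in b by apply/subvP: X.
have [v v0 vb1] : exists2 v : 'rV[C]_m, v != 0 & forall X, X \in b1 -> (v *m rho X <= v)%MS.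
  apply: IH bk => [X Y bX bY|X Y bX bY]; first by apply: rhoM; apply: inb.
  by apply: lie_derivedP; apply: inb.
have [i vi0] : exists i, v 0 i != 0 by apply/rV0Pn.
pose lam X := (v *m rho X) 0 i / v 0 i.
have vlam X : X \in b1 -> v *m rho X = lam X *: v.
  move=> /vb1/sub_rVP[c vc]; rewrite /lam vc; congr (_ *: _).
  by rewrite mxE mulfK.
have lamL c X Y : lam (c *: X + Y) = c * lam X + lam Y.
  by rewrite /lam linearP /= mulmxDr mxE -scalemxAr mxE mulrDl mulrA.
pose W : 'M[C]_m :=
  (\bigcap_(j < \dim b1) eigenspace (rho (vbasis b1)`_j) (lam (vbasis b1)`_j))%MS.
have WP p (A : 'M_(p, m)) : (A <= W)%MS <-> forall X, X \in b1 -> A *m rho X = lam X *: A.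
  split=> [/sub_bigcapmxP AW X bX | AX]; last first.
    apply/sub_bigcapmxP => j _; apply/eigenspaceP; apply: AX.
    by apply: vbasis_mem; rewrite mem_nth ?size_tuple.
  rewrite (coord_vbasis bX); move: (fun j => coord (vbasis b1) j X) => co.
  elim/big_rec: _ => [|j y _ IHy].
    have -> : lam 0 = 0 by rewrite /lam linear0 mulmx0 mxE mul0r.
    by rewrite linear0 mulmx0 scale0r.
  rewrite lamL scalerDl linearP /= mulmxDr IHy -scalemxAr -scalerA.
  by congr (_ *: _ + _); apply/eigenspaceP/AW.
have br0 X Y : X \in b1 -> Y \in b -> lam (lie_bracket X Y) = 0.
  move=> bX bY; pose br Z := lie_bracket Z Y.
  apply: (@weight_bracket0 _ _ _ (fun Z => Z \in b1) rho br lam (rho Y) v) bX => //.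
  move=> Z bZ; split; last by rewrite rhoM // inb.
  by apply: lie_derivedP => //; apply: inb.
have Wst Y : Y \in b -> (W *m rho Y <= W)%MS.
  move=> bY; apply/WP => X bX; rewrite -mulmxA.
  have -> : rho Y *m rho X = rho X *m rho Y - rho (lie_bracket X Y).
    by rewrite rhoM // ?inb // /lie_bracket opprB addrC subrK.
  have bXY : lie_bracket X Y \in b1 by apply: lie_derivedP => //; apply: inb.
  have := WP _ W; rewrite submx_refl => -[/(_ isT) WX _].
  by rewrite mulmxBr mulmxA (WX _ bX) (WX _ bXY) br0 // scale0r subr0 -scalemxAl.
pose W' := row_base W; pose r := \rank W.
have r_gt0 : (0 < r)%N.
  rewrite lt0n mxrank_eq0; apply: contraNneq v0 => W0.
  by rewrite -submx0 -W0; apply/WP.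
have fW' : row_free W' by apply: row_base_free.
pose R X := W' *m rho X *m pinvmx W'.
have RP X : X \in b -> R X *m W' = W' *m rho X.
  move=> bX; apply: mulmxKpV; rewrite /W' (eqmxMr _ (eq_row_base W)) eq_row_base.
  exact: Wst.
have R_lam X Y : X \in b -> Y \in b -> R X *m R Y - R Y *m R X = (lam (lie_bracket X Y))%:M.
  move=> bX bY; apply: (row_free_inj fW').
  rewrite mulmxBl -(mulmxA (R X)) -(mulmxA (R Y)) !RP //.
  rewrite (mulmxA (R X)) (mulmxA (R Y)) !RP // -!(mulmxA W') -mulmxBr.
  have -> : rho X *m rho Y - rho Y *m rho X = rho (lie_bracket X Y) by rewrite rhoM.
  rewrite mul_scalar_mx; apply: (WP _ W').1; first by rewrite eq_row_base.
  exact: lie_derivedP.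
have R_comm X Y : X \in b -> Y \in b -> R X *m R Y = R Y *m R X.
  move=> bX bY; have := congr1 mxtrace (R_lam _ _ bX bY).
  rewrite mxtrace_scalar raddfB /= mxtrace_mulC subrr => /esym/eqP.
  rewrite -mulr_natr mulf_eq0 pnatr_eq0 (gtn_eqF r_gt0) orbF => /eqP lam0.
  by apply/eqP; rewrite -subr_eq0 R_lam // lam0 -scalemx1 scale0r.
have [z z0 /allP zP] : exists2 z : 'rV[C]_r, z != 0 &
    all (fun A => stablemx z A) [seq R X | X <- vbasis b].
  apply: common_eigenvector => // _ _ /mapP[X bX ->] /mapP[Y bY ->].
  by apply: R_comm; apply: vbasis_mem.
exists (z *m W').
  by apply: contra_neq z0 => /eqP; rewrite mulmx_free_eq0 // => /eqP.
move=> X bX; rewrite -mulmxA -RP // mulmxA submxMr //.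
rewrite (coord_vbasis bX) /R linear_sum mulmx_sumr mulmx_suml mulmx_sumr.
apply: summx_sub => j _; rewrite linearZ /= -scalemxAr -scalemxAl -scalemxAr.
apply: scalemx_sub; apply: zP; apply/mapP; exists (vbasis b)`_j => //.
by rewrite mem_nth ?size_tuple.
Qed.

End LieTheorem.

(** * Isotropic flags *)

Section RelativeLie.
Variables (C : numClosedFieldType) (n : nat) (b : {vspace 'M[C]_n}) (d : nat).
Hypothesis b_lie : lie_subalgebra b.
Hypothesis b_sol : iter d (@lie_derived C n) b = 0%VS.

(** Lie's theorem on [E / U], realized on a complement [Q] of [U] in [E] by compressing [X] with the
    projection along [U]. The compression is multiplicative on [b] because the discarded part lies
    in [U], which is stable and killed by the projection. *)
Lemma lie_theorem_subquotient k e (U : 'M[C]_(k, n)) (E : 'M[C]_(e, n)) :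
  (forall X, X \in b -> (U *m X <= U)%MS) ->
  (forall X, X \in b -> (E *m X <= E)%MS) ->
  (U <= E)%MS -> ~~ (E <= U)%MS ->
  exists v : 'rV[C]_n, [/\ (v <= E)%MS, ~~ (v <= U)%MS &
    forall X, X \in b -> (v *m X <= v + U)%MS].
Proof.
move=> Ust Est UE EU.
pose Q := (E :\: U)%MS; pose U1 := <<U>>%MS; pose P := row_base Q.
have QU0 : (Q :&: U1)%MS = 0.
  apply/eqP; rewrite -submx0 -(capmx_diff E U) sub_capmx capmxSl /=.
  by apply: submx_trans (capmxSr _ _) _; rewrite genmxE.
have EQU : (E <= Q + U1)%MS.
  rewrite -(addsmx_diff_cap_eq E U) addsmxS //.
  by apply: submx_trans (capmxSr _ _) _; rewrite genmxE.
have PE : (P <= E)%MS by rewrite eq_row_base diffmxSl.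
have U1st X : X \in b -> (U1 *m X <= U1)%MS.
  by move=> bX; rewrite (eqmxMr _ (genmxE U)) genmxE; apply: Ust.
pose pi := proj_mx Q U1.
have fP : row_free P by apply: row_base_free.
pose rho X := P *m X *m (pi *m pinvmx P).
pose rhoL : {linear 'M[C]_n -> 'M[C]_(\rank Q)} :=
  (mulmxr (pi *m pinvmx P) \o mulmx P : {linear _ -> _}).
have rhoLE X : rhoL X = rho X by [].
have rhoP X : rho X *m P = P *m X *m pi.
  by rewrite /rho mulmxA mulmxKpV // eq_row_base proj_mx_sub.
have compl p (w : 'M_(p, n)) : (w <= E)%MS -> (w - w *m pi <= U1)%MS.
  by move=> wE; apply: proj_mx_compl_sub; apply: submx_trans EQU.
have rhoM X Y : X \in b -> Y \in b ->
    rho X *m rho Y *m P = P *m X *m Y *m pi.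
  move=> bX bY; rewrite -mulmxA rhoP mulmxA mulmxA rhoP.
  apply/eqP; rewrite eq_sym -subr_eq0 -!mulmxBl; apply/eqP.
  apply: proj_mx_0 => //; apply: submx_trans (U1st _ bY); apply: submxMr.
  by apply: compl; apply: submx_trans (Est _ bX); apply: submxMr.
have r_gt0 : (0 < \rank Q)%N.
  rewrite lt0n mxrank_eq0; apply: contra EU => /eqP Q0.
  by move: EQU; rewrite Q0 => /submx_trans; apply; rewrite adds0mx genmxE.
have [X Y bX bY|z z0 zP] := @lie_theorem _ _ _ rhoL d b r_gt0 _ b_lie b_sol.
  apply: (row_free_inj fP); rewrite !rhoLE rhoP mulmxBl !rhoM //.
  by rewrite mulmxBr mulmxBl !mulmxA.
exists (z *m P); split.
- by apply: submx_trans PE; apply: submxMl.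
- apply: contra z0 => zPU; rewrite -(mulmx_free_eq0 _ fP) -submx0 -QU0.
  rewrite sub_capmx genmxE zPU andbT.
  by apply: submx_trans (submxMl _ _) _; rewrite eq_row_base.
move=> X bX; rewrite -[_ *m X](subrK (z *m P *m X *m pi)) addrC.
rewrite addmx_sub_adds //.
  have -> : z *m P *m X *m pi = z *m rho X *m P by rewrite -[RHS]mulmxA rhoP !mulmxA.
  by apply: submxMr; apply: zP.
rewrite -(genmxE U); apply: compl; apply: submx_trans (Est _ bX).
by apply: submxMr; apply: submx_trans PE; apply: submxMl.
Qed.

End RelativeLie.

Section IsotropicFlag.
Variables (C : numClosedFieldType) (n : nat).
Local Notation J := (rev_mx C n).

(** The Gram matrix of the rows of [A] and [B]. Subspaces are row spaces here, with matrices acting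
    from the right. *)
Definition pair_mx k m (A : 'M[C]_(k, n)) (B : 'M[C]_(m, n)) := A *m J *m B^T.

Lemma pair_mx_tr k m (A : 'M[C]_(k, n)) (B : 'M[C]_(m, n)) :
  (pair_mx A B)^T = pair_mx B A.
Proof. by rewrite /pair_mx !trmx_mul trmxK tr_rev_mx mulmxA. Qed.

Lemma pair_mxC (u v : 'rV[C]_n) : pair_mx u v = pair_mx v u.
Proof. by rewrite -[RHS]pair_mx_tr; apply/matrixP => i j; rewrite !ord1 [RHS]mxE. Qed.

Lemma pair_mx_skew k m (A : 'M[C]_(k, n)) (B : 'M[C]_(m, n)) X : adj X = - X ->
  pair_mx (A *m X) B = - pair_mx A (B *m X).
Proof.
move=> aX; have XJ : X *m J = - (J *m X^T).
  have {1}-> : X = - adj X by rewrite aX opprK.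
  by rewrite adj_def mulNmx -(mulmxA _ J J) rev_mxK mulmx1.
by rewrite /pair_mx trmx_mul -(mulmxA A) XJ mulmxN mulNmx !mulmxA.
Qed.

Lemma pair_mxDl k m (A A' : 'M[C]_(k, n)) (B : 'M[C]_(m, n)) :
  pair_mx (A + A') B = pair_mx A B + pair_mx A' B.
Proof. by rewrite /pair_mx !mulmxDl. Qed.

Lemma pair_mxDr k m (A : 'M[C]_(k, n)) (B B' : 'M[C]_(m, n)) :
  pair_mx A (B + B') = pair_mx A B + pair_mx A B'.
Proof. by rewrite /pair_mx linearD mulmxDr. Qed.

Lemma pair_mxZl k m a (A : 'M[C]_(k, n)) (B : 'M[C]_(m, n)) :
  pair_mx (a *: A) B = a *: pair_mx A B.
Proof. by rewrite /pair_mx -!scalemxAl. Qed.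

Lemma pair_mxZr k m a (A : 'M[C]_(k, n)) (B : 'M[C]_(m, n)) :
  pair_mx A (a *: B) = a *: pair_mx A B.
Proof. by rewrite /pair_mx linearZ -scalemxAr. Qed.

Lemma pair_mx_sub k m p (A : 'M[C]_(k, n)) (A' : 'M[C]_(p, n)) (B : 'M[C]_(m, n)) :
  (A <= A')%MS -> pair_mx A' B = 0 -> pair_mx A B = 0.
Proof.
move=> /submxP[D ->] AB; have -> : pair_mx (D *m A') B = D *m pair_mx A' B by rewrite /pair_mx !mulmxA.
by rewrite AB mulmx0.
Qed.

Lemma pair_mx_adj k m (A : 'M[C]_(k, n)) (B : 'M[C]_(m, n)) :
  A *m adj B = pair_mx A B *m rev_mx C m.
Proof. by rewrite adj_def /pair_mx !mulmxA. Qed.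

Definition perp_mx k (U : 'M[C]_(k, n)) := kermx (J *m U^T).

Lemma perp_mxP k (U : 'M[C]_(k, n)) p (A : 'M[C]_(p, n)) :
  (A <= perp_mx U)%MS <-> pair_mx A U = 0.
Proof. by rewrite /pair_mx -mulmxA; split=> [/sub_kermxP|/sub_kermxP]. Qed.

Lemma perp_mx_rank k (U : 'M[C]_(k, n)) : (n - k <= \rank (perp_mx U))%N.
Proof. by rewrite mxrank_ker leq_sub2l // rank_leq_col. Qed.

Lemma perp_mx_stable k (U : 'M[C]_(k, n)) X : adj X = - X -> (U *m X <= U)%MS ->
  (perp_mx U *m X <= perp_mx U)%MS.
Proof.
move=> aX UX; apply/perp_mxP; rewrite pair_mx_skew // -pair_mx_tr.
by rewrite (pair_mx_sub UX) ?trmx0 ?oppr0 // -pair_mx_tr (perp_mxP _ _).1 ?trmx0.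
Qed.

(* If v is not isotropic then v X lies in U, so two orthogonal non-isotropic
   eigenvectors modulo U can be combined into an isotropic one. *)
Lemma isotropic_step (b : {vspace 'M[C]_n}) d k (U : 'M[C]_(k, n)) :
  lie_subalgebra b -> iter d (@lie_derived C n) b = 0%VS ->
  (forall X, X \in b -> adj X = - X) ->
  (forall X, X \in b -> (U *m X <= U)%MS) ->
  pair_mx U U = 0 -> (k + k.+1 < n)%N ->
  exists v : 'rV[C]_n, [/\ pair_mx v v = 0, pair_mx v U = 0, ~~ (v <= U)%MS &
    forall X, X \in b -> (v *m X <= v + U)%MS].
Proof.
move=> lb sb ab Ust UU kn.
have notsub e (E : 'M[C]_(e, n)) : (k < \rank E)%N -> ~~ (E <= U)%MS.
  move=> kE; apply/negP => /mxrankS; rewrite leqNgt => /negP; apply.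
  by apply: leq_ltn_trans kE; apply: rank_leq_row.
(* Skewness gives [(v X, v) = 0]. Since [v] is orthogonal to [U], this is the coefficient of [v] in
   [v X] times [(v, v)], so that coefficient vanishes. *)
have nilp (v : 'rV[C]_n) X : X \in b -> pair_mx v U = 0 -> (v *m X <= v + U)%MS ->
    pair_mx v v != 0 -> (v *m X <= U)%MS.
  move=> bX vU /sub_addsmxP[[D D'] /= vX] vv0.
  have Uv : pair_mx U v = 0 by rewrite -pair_mx_tr vU trmx0.
  have : pair_mx (v *m X) v = 0.
    apply/eqP; have := pair_mx_skew v v (ab X bX).
    rewrite [in RHS]pair_mxC => /eqP; rewrite -addr_eq0 -mulr2n -scaler_nat scaler_eq0.
    by rewrite pnatr_eq0.
  rewrite vX pair_mxDl [D]mx11_scalar mul_scalar_mx pair_mxZl.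
  rewrite [X in _ + X](@pair_mx_sub _ _ _ _ U) ?submxMl // addr0 => /eqP.
  rewrite scaler_eq0 (negPf vv0) orbF => /eqP->.
  by rewrite scale0r add0r submxMl.
have st1 X : X \in b -> (perp_mx U *m X <= perp_mx U)%MS.
  by move=> bX; apply: perp_mx_stable; [apply: ab | apply: Ust].
have [||v [vE vU vst]] := lie_theorem_subquotient lb sb Ust st1.
- exact/perp_mxP.
- by apply: notsub; apply: leq_trans (perp_mx_rank U); lia.
have vU0 := (perp_mxP _ _).1 vE.
have [vv0|vv0] := eqVneq (pair_mx v v) 0; first by exists v.
(* A second eigenvector modulo [U] is sought in the orthogonal of [v] and [U], whose rank is at
   least [n - k - 1 > k]. *)
pose V := col_mx v U.
have Vst X : X \in b -> (V *m X <= V)%MS.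
  move=> bX; rewrite /V mul_col_mx col_mx_sub -!addsmxE vst //=.
  by apply: submx_trans (Ust _ bX) (addsmxSr _ _).
have pairV p (A : 'M_(p, n)) : pair_mx A V = 0 <-> pair_mx A v = 0 /\ pair_mx A U = 0.
  rewrite /pair_mx /V tr_col_mx mul_mx_row; split=> [AV|[-> ->]]; last exact: row_mx0.
  by split; [have := congr1 lsubmx AV | have := congr1 rsubmx AV];
    rewrite ?row_mxKl ?row_mxKr linear0.
have st2 X : X \in b -> (perp_mx V *m X <= perp_mx V)%MS.
  by move=> bX; apply: perp_mx_stable; [apply: ab | apply: Vst].
have [||w [wE wU wst]] := lie_theorem_subquotient lb sb Ust st2.
- by apply/perp_mxP/pairV; split=> //; rewrite -pair_mx_tr vU0 trmx0.
- by apply: notsub; apply: leq_trans (perp_mx_rank V); lia.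
have /pairV[wv0 wU0] := (perp_mxP _ _).1 wE.
have [ww0|ww0] := eqVneq (pair_mx w w) 0; first by exists w.
have [a aE] : exists a, pair_mx v v = a%:M by exists (pair_mx v v 0 0); apply: mx11_scalar.
have [c cE] : exists c, pair_mx w w = c%:M by exists (pair_mx w w 0 0); apply: mx11_scalar.
have c0 : c != 0 by apply: contraNneq ww0 => c0; rewrite cE c0 raddf0.
(* Chosen so that [(v + t w, v + t w) = a + t^2 c = 0]. *)
pose t := sqrtC (- a / c).
exists (v + t *: w); split.
- rewrite pair_mxDl !pair_mxDr !pair_mxZl !pair_mxZr wv0 [pair_mx v w]pair_mxC wv0.
  rewrite scaler0 addr0 add0r scalerA -expr2 sqrtCK aE cE scale_scalar_mx.
  by rewrite divfK // -raddfD subrr raddf0.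
- by rewrite pair_mxDl pair_mxZl vU0 wU0 scaler0 addr0.
- apply: contra vv0 => /pair_mx_sub sub.
  have Uv : pair_mx U v = 0 by rewrite -pair_mx_tr vU0 trmx0.
  by have := sub _ v Uv; rewrite pair_mxDl pair_mxZl wv0 scaler0 addr0 => ->.
move=> X bX; apply: submx_trans (addsmxSr _ _).
rewrite mulmxDl -scalemxAl addmx_sub ?scalemx_sub //; apply: nilp => //.
  exact: vst.
exact: wst.
Qed.

Lemma upper_block p q (A : 'M[C]_p) (B : 'M[C]_(p, q)) (D : 'M[C]_q) :
  upper A -> upper D -> upper (block_mx A B 0 D).
Proof.
move=> uA uD i j; rewrite addn0.
case: (split_ordP i) => i' ->; case: (split_ordP j) => j' -> /= ij.
- by rewrite block_mxEul uA // addn0.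
- by have := ltn_ord i'; lia.
- by rewrite block_mxEdl mxE.
- by rewrite block_mxEdr uD // addn0; lia.
Qed.

(** The new vector goes in as first row: its image is a combination of itself and the old rows, so
    [T] stays upper triangular. *)
Lemma isotropic_flag (b : {vspace 'M[C]_n}) d k :
  lie_subalgebra b -> iter d (@lie_derived C n) b = 0%VS ->
  (forall X, X \in b -> adj X = - X) -> (k + k <= n)%N ->
  exists U : 'M[C]_(k, n), [/\ row_free U, pair_mx U U = 0 &
    forall X, X \in b -> exists2 T, upper T & U *m X = T *m U].
Proof.
move=> lb sb ab; elim: k => [_|k IH kn].
  exists 0; split; first by rewrite -row_leq_rank.
    by rewrite /pair_mx !mul0mx.
  by move=> X _; exists 0; [case | rewrite !mul0mx].
have [|U [fU UU UT]] := IH; first by lia.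
have Ust X : X \in b -> (U *m X <= U)%MS.
  by move=> /UT[T _ ->]; apply: submxMl.
have [|v [vv vU nvU vst]] := isotropic_step lb sb ab Ust UU; first by lia.
have VV : pair_mx (col_mx v U) (col_mx v U) = 0 :> 'M_(1 + k).
  rewrite /pair_mx tr_col_mx mul_col_mx mul_col_row -/(pair_mx v v) -/(pair_mx v U).
  rewrite -/(pair_mx U v) -/(pair_mx U U) vv vU UU -pair_mx_tr vU trmx0.
  by rewrite -[RHS]block_mx0.
have VX X : X \in b -> exists2 T : 'M[C]_(1 + k), upper T &
    col_mx v U *m X = T *m col_mx v U.
  move=> bX; have [T uT UX] := UT X bX.
  have /sub_addsmxP[[a t] /= vX] := vst X bX.
  exists (block_mx a t 0 T); last by rewrite mul_block_col mul_col_mx vX UX mul0mx add0r.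
  by apply: upper_block => // i j; rewrite !ord1.
exists (col_mx v U); split=> //.
have rkE : \rank (col_mx v U) = \rank (v + U)%MS by rewrite addsmxE.
suff : (k < \rank (v + U)%MS)%N by rewrite -rkE -row_leq_rank.
rewrite -[X in (X < _)%N](eqP fU).
apply: rank_ltmx; rewrite /ltmx addsmxSr /=; apply: contra nvU.
by apply: submx_trans; apply: addsmxSl.
Qed.

End IsotropicFlag.

Lemma adj_col_mx (C : fieldType) l n (W U : 'M[C]_(l, n)) :
  adj (col_mx W U) = row_mx (adj U) (adj W).
Proof.
apply/matrixP => i j; rewrite adjE.
case: (split_ordP j) => k ->.
  have -> : rev_ord (lshift l k) = rshift l (rev_ord k).
    by apply: val_inj => /=; have := ltn_ord k; lia.
  by rewrite col_mxEd row_mxEl adjE.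
have -> : rev_ord (rshift l k) = lshift l (rev_ord k).
  by apply: val_inj => /=; have := ltn_ord k; lia.
by rewrite col_mxEu row_mxEr adjE.
Qed.

(** A stable isotropic flag [U] of half dimension and a dual isotropic [W] form a hyperbolic basis.
    There the lower left block of [X] vanishes, the lower right one is triangular by stability of
    the flag, and the upper left one is minus its adjoint. *)
Lemma so_triangularizable (C : numClosedFieldType) n l (b : {vspace 'M[C]_n}) d :
  n = (l + l)%N -> lie_subalgebra b -> iter d (@lie_derived C n) b = 0%VS ->
  (forall X, X \in b -> adj X = - X) ->
  exists2 h : 'M[C]_n, orth h & forall X, X \in b -> upper (h *m X *m adj h).
Proof.
move=> nE; subst n => lb sb ab.
have [U [/row_freeP[B UB] UU UT]] := isotropic_flag lb sb ab (leqnn (l + l)).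
have UaU : U *m adj U = 0 by rewrite pair_mx_adj UU mul0mx.
pose S := adj B *m B; have aS : adj S = S by rewrite adjM adjK.
(* The rows of [adj B] are dual to [U]; subtracting half of their Gram matrix [S] times [U] makes
   them isotropic and keeps the duality. *)
pose W := adj B - 2%:R^-1 *: (S *m U).
have aW : adj W = B - 2%:R^-1 *: (adj U *m S).
  by rewrite linearB linearZ /= adjK adjM aS.
have UW : U *m adj W = 1%:M.
  by rewrite aW mulmxBr UB -scalemxAr mulmxA UaU mul0mx scaler0 subr0.
have WU : W *m adj U = 1%:M by rewrite -[W]adjK -adjM UW adj1.
have WW : W *m adj W = 0.
  rewrite {2}/W linearB linearZ /= adjK [adj (S *m U)]adjM aS mulmxBr -scalemxAr.
  rewrite mulmxA WU mul1mx /W mulmxBl -/S -scalemxAl -mulmxA UB mulmx1.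
  rewrite -addrA -opprD -scalerDl.
  have -> : 2%:R^-1 + 2%:R^-1 = 1 :> C by rewrite -[LHS]mulr2n -[LHS]mulr_natr mulVf // pnatr_eq0.
  by rewrite scale1r subrr.
pose h : 'M[C]_(l + l) := col_mx W U.
have hah : h *m adj h = 1%:M.
  by rewrite adj_col_mx mul_col_row WU WW UaU UW -scalar_mx_block.
exists h => [|X bX]; first exact: mulmx1C.
have [T uT UX] := UT X bX.
rewrite adj_col_mx mul_col_mx mul_col_row UX -!(mulmxA T) UaU UW mulmx0 mulmx1.
apply: upper_block => //.
have -> : W *m X *m adj U = - adj T.
  have -> : T = U *m X *m adj W by rewrite UX -mulmxA UW mulmx1.
  by rewrite adjM adjK adjM ab // mulNmx mulmxN opprK mulmxA.
by move=> i j ij; rewrite mxE (upper_adj uT) // oppr0.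
Qed.

(** * Borel subalgebras of so(2l) *)

Section BorelSubalgebras.
Variables (C : numClosedFieldType) (l : nat).
Local Notation n := (2 * l)%N.
Local Notation M := 'M[C]_n.

Lemma bform_deltal i (v : 'cV[C]_n) : bform (delta_mx i 0) v = v (rev_ord i) 0.
Proof.
rewrite /bform (bigD1 i) //= mxE !eqxx mul1r big1 ?addr0 // => j ji.
by rewrite mxE (negPf ji) mul0r.
Qed.

Lemma bform_adj (A : M) u v : bform (A *m u) v = bform u (adj A *m v).
Proof.
have bformE (w z : 'cV[C]_n) : bform w z = (adj w *m z) 0 0.
  rewrite mxE /bform (reindex_inj rev_ord_inj); apply: eq_bigr => i _.
  by rewrite adjE !ord1 rev_ordK; congr (w _ _ * _); apply/eqP; rewrite -val_eqE.
by rewrite !bformE adjM mulmxA.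
Qed.

Lemma bform_inj (A B : M) : (forall u v, bform u (A *m v) = bform u (B *m v)) -> A = B.
Proof.
move=> AB; apply/matrixP => i j; have := AB (delta_mx (rev_ord i) 0) (delta_mx j 0).
by rewrite !bform_deltal rev_ordK -!colE !mxE.
Qed.

Lemma SOP (g : M) : SO g <-> orth g /\ \det g = 1.
Proof.
split=> -[og dg]; split=> //; last by move=> u v; rewrite bform_adj mulmxA og mul1mx.
by apply: bform_inj => u v; rewrite -mulmxA -bform_adj og mul1mx.
Qed.

Lemma soP (X : M) : so X <-> adj X = - X.
Proof.
have bformN (u v : 'cV[C]_n) : bform u (- v) = - bform u v.
  by rewrite /bform -sumrN; apply: eq_bigr => i _; rewrite mxE mulrN.
split=> [sX | aX u v].
  apply: bform_inj => u v; rewrite -bform_adj mulNmx bformN.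
  by apply/eqP; rewrite -addr_eq0; apply/eqP/sX.
by rewrite bform_adj aX mulNmx bformN addNr.
Qed.

Lemma mem_AdP (g : M) b X : g \in unitmx -> X \in Ad g b <-> invmx g *m X *m g \in b.
Proof.
move=> ug; split=> [/memv_Ad[Y bY ->]|bX]; first by rewrite !mulmxA mulVmx // mul1mx mulmxKV.
by apply/memv_Ad; exists (invmx g *m X *m g); rewrite // !mulmxA mulmxV // mul1mx mulmxK.
Qed.

Lemma vspaceP_iff (b b' : {vspace M}) : (forall X, X \in b <-> X \in b') -> b = b'.
Proof. by move=> bb'; apply/vspaceP => X; apply/idP/idP => /bb'. Qed.

Lemma invmx_mul k (g h : 'M[C]_k) : g \in unitmx -> h \in unitmx ->
  invmx (g *m h) = invmx h *m invmx g.
Proof.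
move=> ug uh; have ugh : g *m h \in unitmx by rewrite unitmx_mul ug.
apply: (can_inj (mulKmx ugh)).
by rewrite mulmxV // mulmxA mulmxK // mulmxV.
Qed.

Lemma AdM (g h : M) b : g \in unitmx -> h \in unitmx -> Ad (g *m h) b = Ad g (Ad h b).
Proof.
move=> ug uh; have ugh : g *m h \in unitmx by rewrite unitmx_mul ug.
apply: vspaceP_iff => X; rewrite (mem_AdP _ _ ugh).
rewrite (mem_AdP _ _ ug) (mem_AdP _ _ uh) invmx_mul //.
by rewrite !mulmxA.
Qed.

Lemma Ad1 (b : {vspace M}) : Ad 1%:M b = b.
Proof.
apply: vspaceP_iff => X; rewrite (mem_AdP _ _ (unitmx1 _ _)).
have -> : invmx (1%:M : M) = 1%:M by rewrite -[LHS]mul1mx mulmxV // unitmx1.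
by rewrite mul1mx mulmx1.
Qed.

Lemma AdK (g : M) b : g \in unitmx -> Ad (invmx g) (Ad g b) = b.
Proof. by move=> ug; rewrite -AdM ?unitmx_inv // mulVmx // Ad1. Qed.

Lemma dim_Ad (g : M) b : g \in unitmx -> \dim (Ad g b) = \dim b.
Proof.
move=> ug; apply: limg_dim_eq; apply/eqP; rewrite -subv0; apply/subvP => X.
rewrite memv_cap memv_ker lfunE /= memv0 => /andP[_ /eqP gX].
by rewrite -(mulKmx ug X) -[g *m X](mulmxKV ug) gX mul0mx mulmx0.
Qed.

Lemma lie_bracket_conj (g : M) X Y : g \in unitmx ->
  invmx g *m lie_bracket X Y *m g = lie_bracket (invmx g *m X *m g) (invmx g *m Y *m g).
Proof.
move=> ug; rewrite /lie_bracket mulmxBr mulmxBl.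
by rewrite !mulmxA !(mulmxK ug).
Qed.

Lemma lie_subalgebra_Ad (g : M) b : g \in unitmx -> lie_subalgebra b -> lie_subalgebra (Ad g b).
Proof.
move=> ug lb X Y /(mem_AdP _ _ ug) bX /(mem_AdP _ _ ug) bY.
by apply/(mem_AdP _ _ ug); rewrite lie_bracket_conj //; apply: lb.
Qed.

Lemma tri_bracket k m (X Y : M) : tri (@nat_of_ord n) k X -> tri (@nat_of_ord n) m Y ->
  tri (@nat_of_ord n) (k + m) (lie_bracket X Y).
Proof.
move=> tX tY; apply: triD; first exact: triM.
by move=> i j ij; rewrite mxE (triM tY tX) ?oppr0 // [(m + k)%N]addnC.
Qed.

(** The diagonal entries of products of upper triangular matrices multiply, hence cancel in a
    bracket. *)
Lemma upper_bracket (X Y : M) : upper X -> upper Y -> tri (@nat_of_ord n) 1 (lie_bracket X Y).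
Proof.
move=> uX uY i j; rewrite addn1 ltnS leq_eqVlt => /orP[/eqP/val_inj->|ji]; last first.
  by apply: (tri_bracket uX uY); rewrite !addn0.
have diagM (A B : M) : upper A -> upper B -> (A *m B) i i = A i i * B i i.
  move=> uA uB; rewrite mxE (bigD1 i) //= big1 ?addr0 // => k ki.
  have [lt_ik|lt_ki|/val_inj eq_ik] := ltngtP i k.
  - by rewrite [B _ _]uB ?mulr0 // addn0.
  - by rewrite uA ?mul0r // addn0.
  - by rewrite eq_ik eqxx in ki.
by rewrite mxE [X in _ + X]mxE !diagM // mulrC subrr.
Qed.

(** After conjugation, the first derived algebra has zero diagonal, and each further one loses at
    least one more diagonal. *)
Lemma conj_upper_solvable (g : M) (b : {vspace M}) : g \in unitmx ->
  (forall X, X \in b -> upper (invmx g *m X *m g)) -> lie_solvable b.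
Proof.
move=> ug ub; exists n.+1.
suff sub k : (iter k.+1 (@lie_derived C n) b <= Ad g (tri_space C (@nat_of_ord n) k.+1))%VS.
  apply/eqP; rewrite -subv0; apply: subv_trans (sub n) _.
  apply/subvP => X /(mem_AdP _ _ ug)/mem_tri_space tX; rewrite memv0.
  suff gX : invmx g *m X *m g = 0.
    by rewrite -(mulKVmx ug X) -[invmx g *m X](mulmxK ug) gX mul0mx mulmx0.
  apply/matrixP => i j; rewrite tX ?mxE //.
  by have := ltn_ord j; lia.
elim: k => [|k IH].
  apply/lie_derived_subP => X Y bX bY; apply/(mem_AdP _ _ ug)/mem_tri_space.
  by rewrite lie_bracket_conj //; apply: upper_bracket; apply: ub.
rewrite iterS; apply/lie_derived_subP => X Y.
move=> /(subvP IH)/(mem_AdP _ _ ug)/mem_tri_space tX.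
move=> /(subvP IH)/(mem_AdP _ _ ug)/mem_tri_space tY.
apply/(mem_AdP _ _ ug)/mem_tri_space; rewrite lie_bracket_conj //.
by apply: triW (tri_bracket tX tY); lia.
Qed.

Definition borel0 : {vspace M} :=
  (tri_space C (@nat_of_ord n) 0 :&: lker (linfun (adj (m := n) (n := n) \+ idfun)))%VS.

Lemma mem_borel0 X : X \in borel0 <-> upper X /\ adj X = - X.
Proof.
rewrite memv_cap; split=> [/andP[/mem_tri_space uX]|[uX aX]].
  by rewrite memv_ker lfunE /= addr_eq0 => /eqP.
by apply/andP; split; [apply/mem_tri_space | rewrite memv_ker lfunE /= aX addNr].
Qed.

Lemma borel0_lie : lie_subalgebra borel0.
Proof.
move=> X Y /mem_borel0[uX aX] /mem_borel0[uY aY]; apply/mem_borel0; split.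
  exact: (tri_bracket uX uY).
by rewrite linearB /= !adjM aX aY !mulNmx !mulmxN !opprK opprB.
Qed.

Lemma adj_conj (g X : M) : orth g -> adj X = - X -> adj (adj g *m X *m g) = - (adj g *m X *m g).
Proof. by move=> og aX; rewrite adjM adjM adjK aX mulNmx mulmxN mulmxA. Qed.

Lemma Ad_borel0_solvable g : orth g -> solvable_subalgebra (@so C l) (Ad g borel0).
Proof.
move=> og; have ug := orth_unit og; split.
- move=> X /(mem_AdP _ _ ug)/mem_borel0[_ aX]; apply/soP.
  have -> : X = adj (adj g) *m (invmx g *m X *m g) *m adj g.
    by rewrite adjK -(orth_inv og) !mulmxA mulmxV // mul1mx mulmxK.
  exact: adj_conj (orth_adj og) aX.
- exact: lie_subalgebra_Ad borel0_lie.
- by apply: (conj_upper_solvable ug) => X /(mem_AdP _ _ ug)/mem_borel0[].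
Qed.

Lemma solvable_sub_Ad b : solvable_subalgebra (@so C l) b ->
  exists2 g, orth g & (b <= Ad g borel0)%VS.
Proof.
move=> [sb lb [d bd]]; have nE : n = (l + l)%N by rewrite mul2n addnn.
have ab X : X \in b -> adj X = - X by move=> /sb/soP.
have [h oh uh] := so_triangularizable nE lb bd ab.
exists (adj h); first exact: orth_adj.
have uah := orth_unit (orth_adj oh).
apply/subvP => X bX; apply/(mem_AdP _ _ uah)/mem_borel0.
rewrite (orth_inv (orth_adj oh)) adjK; split; first exact: uh.
by have := adj_conj (orth_adj oh) (ab X bX); rewrite adjK.
Qed.

(** Maximality is a matter of dimension: the orthogonal conjugates of [borel0] all have the same
    dimension, and every solvable subalgebra lies in one of them. *)
Lemma borel_soP b : flag_variety_so b <-> exists2 g, orth g & b = Ad g borel0.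
Proof.
split=> [[sb maxb] | [g og ->]].
  have [g og bg] := solvable_sub_Ad sb.
  by exists g => //; rewrite (maxb _ (Ad_borel0_solvable og) bg).
split; first exact: Ad_borel0_solvable.
move=> b' sb' gb'; have [h oh b'h] := solvable_sub_Ad sb'.
apply/eqP; rewrite eq_sym eqEdim gb' /= (dim_Ad _ (orth_unit og)).
by rewrite -(dim_Ad borel0 (orth_unit oh)) dimvS.
Qed.

End BorelSubalgebras.

(** An increasing [t] satisfies [i <= t i], so [perm_of_le] applies to its inverse. *)
Lemma incr_perm n (t : {perm 'I_n}) :
  (forall i j : 'I_n, (i < j)%N -> (t i < t j)%N) -> t = 1%g.
Proof.
move=> incr; apply: invg_inj; rewrite invg1; apply: perm_of_le => j.
rewrite -{2}(permKV t j); move: ((t^-1)%g j) => {j}i.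
elim/ltn_ind: {i}(i : nat) {-2}i (erefl (i : nat)) => -[|m] IH i im; first by rewrite im.
have im' : (m < n)%N by have := ltn_ord i; lia.
have := IH m (ltnSn m) (Ordinal im') erefl; have := incr (Ordinal im') i.
by rewrite im /= => /(_ (ltnSn m)); lia.
Qed.

(** * The normalizer of the standard Borel subalgebra *)

Section MiddleSwap.
Variable l : nat.
Local Notation n := (2 * l.+1)%N.

Fact mid1_proof : (l < n)%N. Proof. by lia. Qed.
(** From here on the rank is [l.+1], so the middle positions are [l] and [l.+1]. *)
Definition mid1 : 'I_n := Ordinal mid1_proof.
Definition mid2 : 'I_n := rev_ord mid1.

Lemma mid2E : mid2 = l.+1 :> nat. Proof. by rewrite /=; lia. Qed.

Definition swap : {perm 'I_n} := tperm mid1 mid2.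

Lemma rev_neq (i : 'I_n) : rev_ord i != i.
Proof. by apply/eqP => /(congr1 val) /=; have := ltn_ord i; lia. Qed.

Lemma swap_rev : rev_comm swap.
Proof.
move=> i; rewrite /swap; case: (tpermP mid1 mid2 i) => [->|->|i1 i2].
- by rewrite tpermR rev_ordK.
- by rewrite rev_ordK tpermL.
- by rewrite tpermD // eq_sym; apply/eqP => E; [apply: i2|apply: i1]; rewrite -(rev_ordK i) E ?rev_ordK.
Qed.

Lemma swap_lt (i j : 'I_n) : (i < j)%N -> j != rev_ord i -> (swap i < swap j)%N.
Proof.
rewrite -val_eqE /= /swap; have := ltn_ord i; have := ltn_ord j.
case: tpermP => [->|->|/eqP + /eqP]; case: tpermP => [->|->|/eqP + /eqP] //;
  rewrite -?val_eqE /=; lia.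
Qed.

Lemma rev_comm_mul (s t : {perm 'I_n}) : rev_comm s -> rev_comm t -> rev_comm (s * t)%g.
Proof. by move=> rs rt i; rewrite !permM rs rt. Qed.

(** Only the pairs [i], [rev_ord i] are unconstrained. All of them but the middle one can be
    compared through [mid1], so the order of the images of the middle pair decides, and composing
    with [swap] corrects it. *)
Lemma almost_incr_perm (t : {perm 'I_n}) :
  (forall i j : 'I_n, (i < j)%N -> j != rev_ord i -> (t i < t j)%N) -> t = 1%g \/ t = swap.
Proof.
have incr1 (r : {perm 'I_n}) :
    (forall i j : 'I_n, (i < j)%N -> j != rev_ord i -> (r i < r j)%N) ->
    (r mid1 < r mid2)%N -> r = 1%g.
  move=> incr lt12; apply: incr_perm => i j ij.
  have [jE|] := eqVneq j (rev_ord i); last exact: incr.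
  have [i1|i1] := eqVneq i mid1; first by rewrite jE i1.
  have lt_i1 : (i < mid1)%N.
    by move: i1 ij; rewrite jE -val_eqE /=; have := ltn_ord i; lia.
  apply: (@ltn_trans (r mid1)); apply: incr => //.
  - by rewrite -val_eqE /=; have := ltn_ord i; move: lt_i1 => /=; lia.
  - by rewrite jE /=; move: lt_i1 => /=; lia.
  - by rewrite jE (inj_eq rev_ord_inj).
move=> incr; have [lt12|lt21|/val_inj/perm_inj/eqP] := ltngtP (t mid1) (t mid2).
- by left; apply: incr1.
- right; have : (swap * t)%g = 1%g.
    apply: incr1 => [i j ij ji|]; last by rewrite !permM tpermL tpermR.
    rewrite !permM; apply: incr; first exact: swap_lt.
    by rewrite -swap_rev (inj_eq perm_inj).
  by move/(canRL (mulKg swap)); rewrite mulg1 tpermV.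
by rewrite eq_sym (negPf (rev_neq mid1)).
Qed.

End MiddleSwap.
Arguments mid1 {l}.
Arguments mid2 {l}.
Arguments swap {l}.

Section Normalizer.
Variables (C : numClosedFieldType) (l : nat).
Local Notation n := (2 * l.+1)%N.
Local Notation M := 'M[C]_n.
Local Notation b0 := (borel0 C l.+1).

Lemma adj_delta (i j : 'I_n) : adj (delta_mx i j : M) = delta_mx (rev_ord j) (rev_ord i).
Proof.
apply/matrixP => a b; rewrite adjE !mxE.
by rewrite -(can2_eq rev_ordK rev_ordK) andbC -(can2_eq rev_ordK rev_ordK).
Qed.

(** A root vector of so. It is zero for [j = rev_ord i], whence the side condition [j != rev_ord i]
    in the order conditions. *)
Definition root_mx (i j : 'I_n) : M := delta_mx i j - delta_mx (rev_ord j) (rev_ord i).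

Lemma adj_root i j : adj (root_mx i j) = - root_mx i j.
Proof. by rewrite linearB /= !adj_delta !rev_ordK opprB. Qed.

Lemma tri_root (f : 'I_n -> nat) i j : (f i <= f j)%N ->
  (f (rev_ord j) <= f (rev_ord i))%N -> tri f 0 (root_mx i j).
Proof.
move=> fij fji a b; rewrite addn0 !mxE => ab.
have -> : (a == i) && (b == j) = false.
  by apply/negP => /andP[/eqP ai /eqP bj]; move: ab; rewrite ai bj ltnNge fij.
have -> : (a == rev_ord j) && (b == rev_ord i) = false.
  by apply/negP => /andP[/eqP ai /eqP bj]; move: ab; rewrite ai bj ltnNge fji.
by rewrite subrr.
Qed.

Lemma root_mxE i j : j != rev_ord i -> root_mx i j i j = 1.
Proof.
move=> ji; rewrite !mxE !eqxx (negPf ji) andbF subr0 //.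
Qed.

Lemma Ad_upper (p : M) : orth p -> upper p -> Ad p b0 = b0.
Proof.
move=> op up; have u := orth_unit op.
apply/eqP; rewrite eqEdim (dim_Ad _ u) leqnn andbT.
apply/subvP => X /(mem_AdP _ _ u); rewrite (orth_inv op) => /mem_borel0[uX aX].
have XE : X = p *m (adj p *m X *m p) *m adj p.
  by rewrite !mulmxA (orthC op) mul1mx -mulmxA (orthC op) mulmx1.
apply/mem_borel0; split.
  by rewrite XE; apply: tri0M (upper_adj up); apply: tri0M.
by have := adj_conj (orth_adj op) aX; rewrite adjK -XE.
Qed.

(** The conjugates of upper triangular root vectors stay upper triangular, so the inverse of [s]
    keeps the order of all pairs other than [i], [rev_ord i]. *)
Lemma Ad_perm_borel0 (s : {perm 'I_n}) : rev_comm s ->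
  Ad (perm_mx s) b0 = b0 -> s = 1%g \/ s = swap.
Proof.
move=> rs sb; have us : (perm_mx s : M) \in unitmx by apply: unitmx_perm.
have incr (i j : 'I_n) : (i < j)%N -> j != rev_ord i -> ((s^-1)%g i < (s^-1)%g j)%N.
  move=> ij ji; rewrite ltn_neqAle; apply/andP; split.
    by rewrite (inj_eq val_inj) (inj_eq perm_inj); apply: contraTneq ij => ->; rewrite ltnn.
  rewrite leqNgt; apply/negP => sji.
  pose X := perm_mx s *m root_mx i j *m perm_mx s^-1.
  have : X \in b0.
    rewrite -sb; apply/(mem_AdP _ _ us); rewrite (orth_inv (orth_perm _ rs)) adj_perm //.
    rewrite /X !mulmxA -perm_mxM mulVg perm_mx1 mul1mx -mulmxA -perm_mxM mulVg perm_mx1 mulmx1.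
    apply/mem_borel0; split; last exact: adj_root.
    by apply: tri_root; [apply: ltnW | rewrite /=; lia].
  case/mem_borel0 => uX _.
  have := uX ((s^-1)%g i) ((s^-1)%g j); rewrite addn0 => /(_ sji).
  by rewrite /X perm_conjE !permKV root_mxE // => /eqP; rewrite oner_eq0.
case: (almost_incr_perm incr) => E; [left|right]; rewrite -[s]invgK E ?invg1 //.
exact: tpermV.
Qed.

(** Only the two middle indices contribute to the entry of [adj q *m q] at ([mid1], [mid2]), which
    is twice [q mid1 mid2] times the nonzero [q mid2 mid2]. *)
Lemma mid_corner0 (q : M) : orth q -> upper q -> q mid1 mid2 = 0.
Proof.
move=> oq uq; have /matrixP/(_ mid1 mid2) := oq.
rewrite !mxE eq_sym (negPf (rev_neq mid1)) (bigD1 mid1) //= (bigD1 mid2) ?rev_neq //=.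
rewrite big1 => [|k /andP[k1 k2]]; last first.
  have := k1; have := k2; rewrite -!val_eqE => /= k2' k1'.
  have [k3|k3] := ltnP (@mid2 l) k; first by rewrite [q k _]uq ?mulr0 // addn0.
  by rewrite adjE uq ?mul0r // addn0 -/mid2 mid2E /=; move: k3; rewrite mid2E; lia.
rewrite addr0 !adjE -/mid2 rev_ordK mulrC -mulr2n => /eqP.
rewrite -mulr_natr !mulf_eq0 pnatr_eq0 orbF => /orP[/eqP //|].
by rewrite (negPf (tri_diag_neq0 _ _ (orth_unit oq) uq)) //; apply: val_inj.
Qed.

Lemma swap_conj_upper (X : M) : upper X -> X mid1 mid2 = 0 ->
  upper (perm_mx swap *m X *m perm_mx swap).
Proof.
move=> uX X12 i j; rewrite addn0 -{2}[swap]tpermV perm_conjE => ji.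
have [iE|ij] := eqVneq i (rev_ord j); last by apply: uX; rewrite addn0 swap_lt.
have [j1|j1] := eqVneq j mid1; first by rewrite iE j1 /swap tpermL tpermR.
apply: uX; rewrite addn0 iE swap_rev /swap tpermD 1?eq_sym //.
  by rewrite -iE.
by move: ji; rewrite iE; apply: contraTneq => ->; rewrite /=; lia.
Qed.

(** Skewness kills the ([mid1], [mid2]) entry of an element of [b0], the only one that the exchange
    would bring below the diagonal. *)
Lemma Ad_swap : Ad (perm_mx swap) b0 = b0.
Proof.
have us : (perm_mx swap : M) \in unitmx by apply: unitmx_perm.
apply/eqP; rewrite eqEdim (dim_Ad _ us) leqnn andbT.
have swE : invmx (perm_mx swap : M) = perm_mx swap.
  by rewrite (orth_inv (orth_perm _ (@swap_rev l))) adj_perm ?tpermV //; apply: swap_rev.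
apply/subvP => X /(mem_AdP _ _ us); rewrite swE => /mem_borel0[].
set Y := _ *m X *m _ => uY aY.
have XE : X = perm_mx swap *m Y *m perm_mx swap.
  by rewrite -{1}swE /Y !mulmxA mulVmx // mul1mx -{2}swE mulmxK.
rewrite XE; apply/mem_borel0; split.
  apply: swap_conj_upper => //; have := aY => /matrixP/(_ mid1 mid2).
  rewrite adjE [RHS]mxE rev_ordK -/mid2 => /eqP.
  by rewrite -addr_eq0 -mulr2n mulrn_eq0 /= => /eqP.
have := adj_conj (orth_perm _ (@swap_rev l)) aY.
by rewrite adj_perm ?tpermV //; apply: swap_rev.
Qed.

(** The triangular factors of the Bruhat decomposition normalize [b0], which reduces the claim to
    [Ad_perm_borel0]. When [s = swap], the exchange is moved across the right factor by
    [mid_corner0]. *)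
Lemma normalizer_borel0 (q : M) : orth q -> Ad q b0 = b0 ->
  upper q \/ upper (q *m perm_mx swap).
Proof.
move=> oq qb; have [p [q1 [s [[op up] [oq1 uq1] rs qE]]]] := orth_bruhat oq.
have us : (perm_mx s : M) \in unitmx by apply: unitmx_perm.
have uup := orth_unit op; have uuq := orth_unit oq1.
have sb : Ad (perm_mx s) b0 = b0.
  have psb : Ad p (Ad (perm_mx s) b0) = b0.
    by rewrite -{1}(Ad_upper oq1 uq1) -!AdM ?unitmx_mul ?us ?uup // -qE.
  rewrite -[LHS](AdK _ uup) psb (orth_inv op) Ad_upper //; first exact: orth_adj.
  exact: upper_adj.
case: (Ad_perm_borel0 rs sb) => sE; rewrite qE sE.
  by left; rewrite perm_mx1 mulmx1; apply: tri0M.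
right; rewrite -!mulmxA mulmxA -[_ *m _ *m _]mulmxA; apply: tri0M => //.
by rewrite mulmxA; apply: swap_conj_upper => //; apply: mid_corner0.
Qed.

End Normalizer.

(** * Orbits *)

Section Orbits.
Variables (C : numClosedFieldType) (l : nat).
Local Notation n := (2 * l.+1)%N.
Local Notation M := 'M[C]_n.
Local Notation b0 := (borel0 C l.+1).
Local Notation u0 := (fixed_vector C l.+1).
Implicit Types (s : {perm 'I_n}) (T : {set 'I_n}) (v : 'cV[C]_n).

(* The two middle positions mid1, mid2 carry e_{l+1}, e_{-(l+1)}; for admissible T
   the support of this vector is T itself. *)
Definition support_vector T : 'cV[C]_n :=
  \col_i (if i == mid2 then -1 else (i \in T)%:R).

Definition admissible T : bool :=
  [&& mid1 \in T, mid2 \in T & [forall i in T, (i <= l.+1)%N]].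

Definition antichain s T : bool :=
  [forall i in T, forall j in T, (i < j)%N ==> (j != rev_ord i) ==> (s j < s i)%N].

Lemma admissibleP T : reflect [/\ mid1 \in T, mid2 \in T &
  forall i, i \in T -> (i <= l.+1)%N] (admissible T).
Proof. by apply: (iffP and3P) => -[T1 T2 /forall_inP]. Qed.

Lemma antichainP s T : reflect (forall i j, i \in T -> j \in T -> (i < j)%N ->
  j != rev_ord i -> (s j < s i)%N) (antichain s T).
Proof.
apply: (iffP forall_inP) => [aT i j iT jT ij ji|aT i iT].
  by have /forall_inP/(_ j jT) := aT i iT; rewrite ij ji.
by apply/forall_inP => j jT; apply/implyP => ij; apply/implyP; apply: aT.
Qed.

Lemma support_vectorE T i : mid2 \in T -> (support_vector T i 0 != 0) = (i \in T).
Proof.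
move=> T2; rewrite mxE; have [->|_] := eqVneq i mid2.
  by rewrite T2 oppr_eq0 oner_eq0.
by case: (i \in T); rewrite ?oner_eq0 ?eqxx.
Qed.

Lemma fixed_vectorE : u0 = support_vector [set mid1; mid2].
Proof.
apply/matrixP => i j; rewrite !mxE !inE eqSS -!val_eqE /=.
have -> : (2 * l.+1 - l.+1 = l.+1)%N by lia.
case: (eqVneq (i : nat) l.+1) => [->|_]; last by rewrite orbF subr0.
by have -> : (l.+1 == l) = false; [lia | rewrite sub0r].
Qed.

Lemma mid_le (i : 'I_n) : (i <= l.+1)%N -> (@mid1 l < i)%N -> i = mid2.
Proof. by move=> /= i1 i2; apply/val_inj; rewrite /= ; lia. Qed.

(** A torus element inverting the nonzero entries in the first half, with [1] at vanishing entries;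
    the second half is forced by orthogonality. *)
Definition scaling (v : 'cV[C]_n) (k : 'I_n) : C :=
  let t := fun i : 'I_n => if v i 0 == 0 then 1 else (v i 0)^-1 in
  if (k <= l)%N then t k else (t (rev_ord k))^-1.

Lemma diag_orth (t : 'I_n -> C) : (forall i, t (rev_ord i) * t i = 1) ->
  orth (diag_mx (\row_i t i)).
Proof.
move=> tt; have -> : orth (diag_mx (\row_i t i)) <->
    diag_mx (\row_i t (rev_ord i)) *m diag_mx (\row_i t i) = 1%:M.
  rewrite /orth; suff -> : adj (diag_mx (\row_i t i)) = diag_mx (\row_i t (rev_ord i)) by [].
  apply/matrixP => i j; rewrite adjE !mxE (inj_eq rev_ord_inj) eq_sym.
  by case: eqP => [->|].
rewrite mulmx_diag -(scalemx1 n 1) scale1r -diag_const_mx; congr diag_mx.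
by apply/rowP => i; rewrite !mxE tt.
Qed.

Lemma tri_diag (f : 'I_n -> nat) (t : 'rV[C]_n) : tri f 0 (diag_mx t).
Proof.
move=> i j; rewrite addn0 mxE; case: eqP => [->|//]; by rewrite ltnn.
Qed.

(* Among the entries at positions at most l.+1, a pair i < j violating the
   antichain condition allows the j-th entry to cancel the i-th one. *)
Lemma normal_form s v : rev_comm s ->
  (forall i : 'I_n, (l.+1 < i)%N -> v i 0 = 0) -> v mid1 0 * v mid2 0 = -1 ->
  exists h T, [/\ orth h, upper h, tri (fun i => s i) 0 h,
    admissible T && antichain s T & h *m v = support_vector T].
Proof.
move=> rs; have [m] := ubnP #|[set i | v i 0 != 0]%SET|; elim: m v => // m IH v.
set T := [set i | v i 0 != 0]%SET => Tm v0 v12.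
have v1 : v mid1 0 != 0.
  by apply: contra_eq_neq v12 => ->; rewrite mul0r eq_sym oppr_eq0 oner_eq0.
have v2 : v mid2 0 != 0.
  by apply: contra_eq_neq v12 => ->; rewrite mulr0 eq_sym oppr_eq0 oner_eq0.
have adm : admissible T.
  apply/admissibleP; rewrite !inE; split=> // i; rewrite inE leqNgt.
  by apply: contraNN => /v0->.
have [aT|] := boolP (antichain s T); last first.
  case/forall_inPn => i iT /forall_inPn[j jT].
  rewrite !negb_imply -leqNgt => /and3P[ij ji sij].
  have /admissibleP[_ _ leT] := adm.
  have il : (i < l)%N.
    have := leT j jT; have := ltn_ord i; move: ij ji; rewrite -val_eqE /=; lia.
  pose c := - (v i 0 / v j 0).
  pose x := 1%:M + c *: root_mx C i j.
  have vj0 : v j 0 != 0 by rewrite inE in jT.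
  (* The second term of the root vector reads this entry, so only the first one acts on [v]. *)
  have vri : v (rev_ord i) 0 = 0 by apply: v0 => /=; lia.
  have xv : x *m v = v - v i 0 *: delta_mx i 0.
    rewrite mulmxDl mul1mx -scalemxAl mulmxBl; congr (_ + _).
    apply/matrixP => a b; rewrite ord1 !mxE.
    rewrite (bigD1 j) //= big1 => [|k kj]; last by rewrite mxE (negPf kj) andbF mul0r.
    rewrite (bigD1 (rev_ord i)) //= big1 => [|k ki]; last by rewrite mxE (negPf ki) andbF mul0r.
    rewrite !mxE !eqxx vri mulr0 !addr0 subr0 !andbT.
    by case: eqP => _; rewrite ?mul1r ?mul0r ?mulr0 ?mulr1 ?oppr0 // /c mulNr divfK.
  have xvE k : (x *m v) k 0 = if k == i then 0 else v k 0.
    rewrite xv !mxE eqxx andbT; case: eqP => [->|_]; first by rewrite mulr1 subrr.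
    by rewrite mulr0 subr0.
  have [|||h [T' [oh uh sh admT hxv]]] := IH (x *m v).
  - rewrite -ltnS; apply: leq_trans Tm; apply: proper_card; apply/properP; split.
      by apply/fintype.subsetP => k; rewrite !inE xvE; have [->|_] := eqVneq k i; rewrite ?eqxx.
    by exists i => //; rewrite inE xvE !eqxx.
  - by move=> k /v0 vk; rewrite xvE vk; case: ifP.
  - rewrite !xvE -!val_eqE /= (gtn_eqF il).
    by have -> : (2 * l.+1 - l.+1 == i)%N = false by lia.
  have rij : rev_ord i != j by rewrite eq_sym.
  have nij : i != j by rewrite -val_eqE /= neq_ltn ij.
  (* The root vector squares to zero, so the adjoint [1 - c root] of [x] is its inverse. *)
  have ox : orth x.
    have RR : root_mx C i j *m root_mx C i j = 0.
      rewrite mulmxBl !mulmxBr !mul_delta_mx_cond (inj_eq rev_ord_inj).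
      rewrite [j == i]eq_sym [j == rev_ord j]eq_sym !(negPf nij).
      by rewrite !(negPf (rev_neq _)) !mulr0n !subrr.
    have ax : adj x = 1%:M - c *: root_mx C i j.
      by rewrite /x linearD linearZ /= adj1 adj_root scalerN.
    rewrite /orth ax /x mulmxBl !mulmxDr.
    by rewrite !mul1mx mulmx1 -scalemxAl -scalemxAr RR !scaler0 addr0 addrK.
  have tx (f : 'I_n -> nat) : (f i <= f j)%N -> (f (rev_ord j) <= f (rev_ord i))%N -> tri f 0 x.
    by move=> f1 f2; apply: triD; [apply: tri1 | apply: triZ; apply: tri_root].
  exists (h *m x), T'; split=> //.
  - exact: orthM.
  - by apply: tri0M uh _; apply: tx; [apply: ltnW | rewrite /=; lia].
  - apply: tri0M sh _; apply: tx => //; rewrite !rs /=.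
    by have := ltn_ord (s i); lia.
  - by rewrite -mulmxA.
pose D := diag_mx (\row_k scaling v k).
exists D, T; split; rewrite ?adm //.
- apply: diag_orth => i; rewrite /scaling /= rev_ordK.
  have t0 (k : 'I_n) : (if v k 0 == 0 then 1 else (v k 0)^-1) != 0.
    by case: ifP => [_|/negbT]; rewrite ?oner_eq0 ?invr_eq0.
  have [il|il] := leqP i l.
    have -> : (n - i.+1 <= l)%N = false by have := ltn_ord i; lia.
    by rewrite mulVf.
  have -> : (n - i.+1 <= l)%N by have := ltn_ord i; lia.
  by rewrite mulfV.
- exact: tri_diag.
- exact: tri_diag.
apply/matrixP => i j; rewrite ord1 mul_diag_mx !mxE inE /scaling.
(* The torus multiplies the entry at [mid2] by [v mid1 0], and the product of the middle entries is
   [-1]. *)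
have [->|i2] := eqVneq i mid2.
  have -> : (@mid2 l <= l)%N = false by rewrite mid2E ltnn.
  by rewrite rev_ordK (negPf v1) invrK.
have [il|il] := leqP i l; first by case: eqVneq => [->|vi]; rewrite ?mulr0 // mulVf.
have vi : v i 0 = 0 by apply: v0; move: i2; rewrite -val_eqE /=; lia.
by rewrite vi mulr0 eqxx.
Qed.

(** The normal form for [s = 1]: the only admissible antichain for the natural order is the middle
    pair, the support of [u0]. *)
Lemma normal_form_vec T : admissible T ->
  exists p : M, [/\ orth p, upper p & p *m support_vector T = u0].
Proof.
move=> /admissibleP[T1 T2 leT].
have [i|||h [T' [oh uh _ /andP[/admissibleP[T'1 T'2 leT'] aT'] hT]]] :=
  @normal_form 1%g (support_vector T).
- by rewrite !perm1.
- move=> i il; apply/eqP; rewrite -[_ == _]negbK support_vectorE //.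
  by apply/negP => /leT; rewrite leqNgt il.
- by rewrite !mxE eqxx T1 eq_sym (negPf (rev_neq mid1)) mul1r.
exists h; split=> //; rewrite hT fixed_vectorE; congr support_vector.
apply/setP => i; rewrite !inE; apply/idP/orP => [iT|[/eqP->|/eqP->]//].
case: (ltngtP i (@mid1 l)) => [lt1|gt1|/val_inj->]; last by left.
  have ri : mid1 != rev_ord i by move: lt1; rewrite -val_eqE /=; lia.
  by have := antichainP _ _ aT' i mid1 iT T'1 lt1 ri; rewrite !perm1 ltnNge (ltnW lt1).
by right; rewrite (mid_le (leT' i iT) gt1).
Qed.

(* Matching an entry of v_T' with entries of v_T through h and back through its
   inverse gives i <= j <= k with i, k in T' and j in T. *)
Lemma support_separated s T T' (h : M) : orth h -> upper h -> tri (fun i => s i) 0 h ->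
  admissible T -> admissible T' -> antichain s T' ->
  h *m support_vector T = support_vector T' -> T' \subset T.
Proof.
move=> oh uh sh /admissibleP[T1 T2 leT] /admissibleP[T'1 T'2 leT'] /antichainP aT' hT.
have step (g : M) (A B : {set 'I_n}) : mid2 \in A -> mid2 \in B -> upper g -> tri (fun i => s i) 0 g ->
    g *m support_vector A = support_vector B -> forall i, i \in B ->
    exists j, [/\ j \in A, (i <= j)%N & (s i <= s j)%N].
  move=> A2 B2 ug sg gA i iB.
  have [j gij vj] : exists2 j, g i j != 0 & support_vector A j 0 != 0.
    move: iB; rewrite -support_vectorE // -gA mxE => gi.
    case: (pickP (fun j => (g i j != 0) && (support_vector A j 0 != 0))) => [j /andP[]|no].
      by exists j.
    case/eqP: gi; apply: big1 => j _; have /negbT := no j.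
    by rewrite negb_and !negbK => /orP[]/eqP->; rewrite ?mul0r ?mulr0.
  exists j; rewrite -support_vectorE //; split=> //; rewrite leqNgt; apply: contra gij => ij.
    by rewrite ug ?addn0.
  by rewrite sg ?addn0.
have hT' : adj h *m support_vector T' = support_vector T.
  by rewrite -hT mulmxA oh mul1mx.
have sh' : tri (fun i => s i) 0 (adj h).
  by rewrite -(orth_inv oh); apply: tri_inv => //; apply: orth_unit.
apply/fintype.subsetP => i iT'.
have [j [jT ij sij]] := step _ _ _ T2 T'2 uh sh hT i iT'.
have [k [kT jk sjk]] := step _ _ _ T'2 T2 (upper_adj uh) sh' hT' j jT.
(* If [i = k], then [i = j] lies in [T]. Otherwise the antichain condition forces [k = rev_ord i],
   and admissibility leaves only [i = mid1]. *)
have [ik|ik] := eqVneq i k.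
  suff -> : i = j by [].
  by apply: val_inj; apply/eqP; rewrite eqn_leq ij ik jk.
have lt_ik : (i < k)%N by rewrite ltn_neqAle -(inj_eq val_inj) /= in ik *; rewrite ik (leq_trans ij jk).
have [kE|kE] := eqVneq k (rev_ord i); last first.
  by have := aT' i k iT' kT lt_ik kE; rewrite ltnNge (leq_trans sij sjk).
suff -> : i = mid1 by [].
apply: val_inj; have := leT' k kT; move: lt_ik; rewrite kE /=; have := ltn_ord i; lia.
Qed.

Definition datum := ({perm 'I_n} * {set 'I_n})%type.

(* s and s * swap define the same Borel subalgebra; the condition on the middle
   positions selects one of the two. *)
Definition normalized s : bool := ((s^-1)%g mid1 < (s^-1)%g mid2)%N.

Definition valid (d : datum) : bool :=
  [&& [forall i, d.1 (rev_ord i) == rev_ord (d.1 i)], normalized d.1,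
      admissible d.2 & antichain d.1 d.2].

Lemma validP d : reflect [/\ rev_comm d.1, normalized d.1, admissible d.2 &
  antichain d.1 d.2] (valid d).
Proof.
apply: (iffP and4P) => -[rs ns aT cT]; split=> //; last by apply/forallP => i; rewrite rs.
by move=> i; apply/eqP; apply: (forallP rs).
Qed.

(** No representative [p] is singled out; [datum_orbitE] shows that this is a single orbit. *)
Definition datum_orbit (d : datum) : set {vspace M} :=
  [set b | exists p : M, [/\ orth p, upper p, p *m support_vector d.2 = u0 &
    b = Ad (p *m perm_mx d.1) b0]].

Lemma swap_normalized s : ~~ normalized s -> normalized (s * swap)%g.
Proof.
rewrite /normalized invMg !permM tpermV tpermL tpermR -leqNgt leq_eqVlt.
by case/orP => // /eqP/val_inj/perm_inj/eqP; rewrite (negPf (rev_neq mid1)).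
Qed.

(** The element [q = s'^-1 h s] normalizes [b0], so [bruhat_uniq] gives [s' = s] or [s' = s * swap];
    the latter contradicts [normalized]. Then [support_separated], applied to [h] and to its
    inverse, gives both inclusions between [T] and [T']. *)
Lemma datum_orbit_inj d d' b : valid d -> valid d' ->
  datum_orbit d b -> datum_orbit d' b -> d = d'.
Proof.
case: d d' => [s T] [s' T'] /validP[/= rs ns aT cT] /validP[/= rs' ns' aT' cT'].
move=> [p [op up pT ->]] [p' [op' up' pT' /= bE]].
pose h := adj p' *m p.
have oh : orth h by apply: orthM op; apply: orth_adj.
have uh : upper h by apply: tri0M up; apply: upper_adj.
have hT : h *m support_vector T = support_vector T'.
  by rewrite /h -mulmxA pT -pT' mulmxA op' mul1mx.
pose q := perm_mx s'^-1 *m h *m perm_mx s.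
have oq : orth q.
  apply: orthM (orth_perm _ rs); apply: orthM oh; apply: orth_perm; exact: rev_commV.
have us : (perm_mx s : M) \in unitmx by apply: unitmx_perm.
have us' : (perm_mx s' : M) \in unitmx by apply: unitmx_perm.
have Adq : Ad q b0 = b0.
  have u' : p' *m perm_mx s' \in unitmx by rewrite unitmx_mul us' (orth_unit op').
  rewrite -[RHS](AdK _ u') -bE -AdM ?unitmx_inv ?unitmx_mul ?us ?us' ?(orth_unit op) ?(orth_unit op') //.
  rewrite invmx_mul ?(orth_unit op') // (orth_inv op') (orth_inv (orth_perm _ rs')).
  by rewrite adj_perm // /q /h !mulmxA.
have qE : h *m perm_mx s = perm_mx s' *m q.
  by rewrite /q !mulmxA -perm_mxM mulgV perm_mx1 mul1mx.
have [uq|uq] := normalizer_borel0 oq Adq.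
  have ss := bruhat_uniq (orth_unit oh) uh uq qE; subst s'.
  have sh : tri (fun i => s i) 0 h by apply/tri_perm_conj.
  congr (_, _); apply/eqP; rewrite finset.eqEsubset.
  rewrite (support_separated oh uh sh aT aT' cT' hT) andbT.
  apply: (support_separated (orth_adj oh) (upper_adj uh) _ aT' aT cT).
    by rewrite -(orth_inv oh); apply: tri_inv => //; apply: orth_unit.
  by rewrite -hT mulmxA oh mul1mx.
have ss : (s * swap)%g = s'.
  apply: (bruhat_uniq (orth_unit oh) uh uq).
  by rewrite perm_mxM (mulmxA h) qE -(mulmxA (perm_mx s')).
move: ns'; rewrite -ss /normalized invMg !permM tpermV tpermL tpermR.
by move: ns; rewrite /normalized ltnNge leq_eqVlt negb_or => /andP[_ /negPf->].
Qed.

(** The diagonal entries at [i] and [rev_ord i] are inverse to each other, and the determinant is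
    the product over such pairs. *)
Lemma det_upper_orth (g : M) : orth g -> upper g -> \det g = 1.
Proof.
move=> og ug; rewrite -det_tr det_trig; last first.
  by apply/is_trig_mxP => i j ij; rewrite mxE ug // addn0.
have gg i : g (rev_ord i) (rev_ord i) * g i i = 1.
  have /matrixP/(_ i i) := og; rewrite !mxE eqxx (bigD1 i) //= adjE => E; apply: etrans E.
  rewrite big1 ?addr0 // => k ki; have [ik|ki'|/val_inj E] := ltngtP i k.
  - by rewrite [g k i]ug ?mulr0 // addn0.
  - by rewrite adjE ug ?mul0r // addn0 /=; have := ltn_ord i; lia.
  - by rewrite E eqxx in ki.
under eq_bigr => i _ do rewrite mxE.
rewrite (bigID (fun i : 'I_n => i < l.+1)%N) /=.
rewrite [X in _ * X](reindex_inj rev_ord_inj) /=.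
rewrite [X in _ * X](eq_bigl (fun i : 'I_n => i < l.+1)%N); last first.
  by move=> i /=; have := ltn_ord i; lia.
by rewrite -big_split /= big1 // => i _; rewrite mulrC gg.
Qed.

Lemma B_SO_oddP (g : M) : B_SO_odd g <-> [/\ orth g, upper g & g *m u0 = u0].
Proof.
split=> [[[/SOP[og _] gu] /upper_triangularE ug] // | [og ug gu]].
split; last exact/upper_triangularE.
by split=> //; apply/SOP; split=> //; apply: det_upper_orth.
Qed.

(** Two representatives [p], [q] differ by [q *m adj p], which fixes [u0]. *)
Lemma datum_orbitE d (p : M) : rev_comm d.1 -> orth p -> upper p ->
  p *m support_vector d.2 = u0 ->
  datum_orbit d = Ad_orbit (@B_SO_odd C l.+1) (Ad (p *m perm_mx d.1) b0).
Proof.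
move=> rs op up pT; have us : (perm_mx d.1 : M) \in unitmx by apply: unitmx_perm.
apply/seteqP; split=> [b [q [oq uq qT ->]] | b [k /B_SO_oddP[ok uk ku] <-]].
  have upp : p *m perm_mx d.1 \in unitmx by rewrite unitmx_mul us (orth_unit op).
  exists (q *m adj p).
    apply/B_SO_oddP; split; first by apply: orthM (orth_adj op).
      by apply: tri0M uq _; apply: upper_adj.
    by rewrite -pT -mulmxA [adj p *m _]mulmxA op mul1mx pT.
  have oqp : orth (q *m adj p) by apply: orthM (orth_adj op).
  rewrite -AdM ?(orth_unit oqp) //; congr (Ad _ _).
  by rewrite mulmxA -(mulmxA q) op mulmx1.
have upp : p *m perm_mx d.1 \in unitmx by rewrite unitmx_mul us (orth_unit op).
exists (k *m p); split; first exact: orthM.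
- exact: tri0M.
- by rewrite -mulmxA pT.
- by rewrite -mulmxA [RHS]AdM // (orth_unit ok).
Qed.

Lemma bform_support T : admissible T ->
  bform (support_vector T) (support_vector T) = - 2%:R.
Proof.
move=> /admissibleP[T1 T2 leT]; rewrite /bform (bigD1 mid1) //= (bigD1 mid2) ?rev_neq //=.
rewrite big1 => [|k /andP[k1 k2]].
  have v1 : support_vector T mid1 0 = 1.
    by rewrite mxE eq_sym (negPf (rev_neq mid1)) T1.
  have v2 : support_vector T mid2 0 = -1 by rewrite mxE eqxx.
  by rewrite rev_ordK -/mid2 v1 v2 mulN1r mul1r addr0 -opprD -mulr2n.
have [kl|kl] := leqP k l.+1; last first.
  have kT : k \notin T by apply/negP => /leT; rewrite leqNgt kl.
  by apply/eqP; rewrite mulf_eq0 -[_ == _]negbK support_vectorE // kT.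
have kT : rev_ord k \notin T.
  by apply/negP => /leT; move: k1 k2; rewrite -!val_eqE /=; lia.
by apply/eqP; rewrite mulf_eq0 orbC -[_ == _]negbK support_vectorE // kT.
Qed.

Lemma admissible_mid : admissible [set mid1; mid2].
Proof.
apply/admissibleP; rewrite !inE !eqxx orbT; split=> // i.
by rewrite !inE => /orP[/eqP->|/eqP->] /=; lia.
Qed.

Lemma borel_datum b : flag_variety_so b -> exists2 d, valid d & datum_orbit d b.
Proof.
case/borel_soP => g og ->; have [p [q [s [[op up] [oq uq] rs gE]]]] := orth_bruhat og.
have [s' [rs' ns' ->]] : exists s', [/\ rev_comm s', normalized s' &
    Ad g b0 = Ad (p *m perm_mx s') b0].
  have us : (perm_mx s : M) \in unitmx by apply: unitmx_perm.
  have ups : p *m perm_mx s \in unitmx by rewrite unitmx_mul us (orth_unit op).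
  have gE' : Ad g b0 = Ad (p *m perm_mx s) b0.
    by rewrite gE AdM ?(orth_unit oq) // (Ad_upper oq uq).
  have [ns|/swap_normalized ns] := boolP (normalized s); first by exists s.
  exists (s * swap)%g; split=> //; first exact: rev_comm_mul rs (@swap_rev l).
  by rewrite perm_mxM mulmxA AdM ?unitmx_perm // Ad_swap.
pose v := adj p *m u0.
have v0 (i : 'I_n) : (l.+1 < i)%N -> v i 0 = 0.
  move=> il; rewrite mxE big1 // => k _; have [ki|ik] := ltnP k i.
    by rewrite (upper_adj up) ?mul0r // addn0.
  rewrite [u0 _ _]mxE; have kl := leq_trans il ik.
  by rewrite (gtn_eqF kl) eqSS (gtn_eqF (ltnW kl)) subrr mulr0.
(* The form takes the value [-2] at [v] as at [u0], and at [v] it reduces to twice the product of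
   the middle entries. *)
have v12 : v mid1 0 * v mid2 0 = -1.
  have : bform v v = - 2%:R.
    rewrite bform_adj adjK mulmxA (orthC op) mul1mx fixed_vectorE.
    exact/bform_support/admissible_mid.
  rewrite /bform (bigD1 mid1) //= (bigD1 mid2) ?rev_neq //= big1 => [|k /andP[k1 k2]].
    rewrite rev_ordK addr0 [v mid2 _ * _]mulrC -mulr2n -[_ *+ 2]mulr_natr -mulN1r.
    by apply: mulIf; rewrite pnatr_eq0.
  have [kl|kl] := ltnP l.+1 k; first by rewrite v0 ?mul0r.
  by rewrite [X in _ * X]v0 ?mulr0 //; move: k1 k2; rewrite -!val_eqE /=; lia.
have [h [T [oh uh sh /andP[aT cT] hv]]] := normal_form rs' v0 v12.
exists (s', T); first exact/validP.
have us' : (perm_mx s' : M) \in unitmx by apply: unitmx_perm.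
have uah := upper_adj uh; have oah := orth_adj oh.
exists (p *m adj h); split; [exact: orthM | exact: tri0M | |].
  by rewrite /= -hv -mulmxA [adj h *m _]mulmxA oh mul1mx mulmxA (orthC op) mul1mx.
(* As [h] is also triangular for the ranking by [s'], its inverse crosses [s'] as an upper
   triangular orthogonal matrix, which normalizes [b0]. *)
pose k := perm_mx s'^-1 *m adj h *m perm_mx s'.
have ok : orth k.
  by apply: orthM (orth_perm _ rs'); apply: orthM oah; apply/orth_perm/rev_commV.
have uk : upper k.
  apply/tri_perm_conj; rewrite -(orth_inv oh); apply: tri_inv => //; exact: orth_unit.
have -> : p *m adj h *m perm_mx s' = p *m perm_mx s' *m k.
  by rewrite /k !mulmxA -(mulmxA p (perm_mx s')) -perm_mxM mulgV perm_mx1 mulmx1.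
have ups : p *m perm_mx s' \in unitmx by rewrite unitmx_mul us' (orth_unit op).
by rewrite [RHS]AdM ?(orth_unit ok) // (Ad_upper ok uk).
Qed.

Lemma orbit_setE :
  orbit_set (@B_SO_odd C l.+1) (@flag_variety_so C l.+1) =
  [set datum_orbit d | d in [set d | valid d]].
Proof.
apply/seteqP; split=> [_ [b fb <-] | _ [d vd <-]].
  have [d vd [p [op up pT bE]]] := borel_datum fb.
  by exists d => //; rewrite bE; apply: datum_orbitE => //; case/validP: vd.
have /validP[rs _ aT _] := vd; have [p [op up pT]] := normal_form_vec aT.
exists (Ad (p *m perm_mx d.1) b0).
  apply/borel_soP; exists (p *m perm_mx d.1) => //.
  by apply: orthM op _; apply: orth_perm.
by rewrite (datum_orbitE rs op up pT).
Qed.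

Lemma datum_orbit_nonempty d : valid d -> exists b, datum_orbit d b.
Proof.
move=> /validP[_ _ /normal_form_vec[p [op up pT]] _].
by exists (Ad (p *m perm_mx d.1) b0), p.
Qed.

Lemma orbit_set_card :
  (orbit_set (@B_SO_odd C l.+1) (@flag_variety_so C l.+1) #= `I_#|valid|)%card.
Proof.
rewrite orbit_setE.
have inj : {in [set d | valid d] &, injective datum_orbit}.
  move=> d d' /set_mem vd /set_mem vd' E.
  have [b db] := datum_orbit_nonempty vd.
  by apply: (datum_orbit_inj vd vd' db); rewrite -E.
rewrite (card_eql (inj_card_eq inj)) (card_eqr card_II) card_eq_sym.
have -> : [set d | valid d] = [set enum_val i | i in [set: 'I_#|valid|]].
  apply/seteqP; split=> [d /= vd|_ [i _ <-]]; last by have := enum_valP i; rewrite unfold_in.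
  by exists (enum_rank_in vd d) => //; apply: enum_rankK_in.
rewrite card_eq_sym; apply: inj_card_eq => i j _ _; exact: enum_val_inj.
Qed.

End Orbits.

(** * Counting *)

Section IncreasingPermutations.
Variables (L : nat) (A : {set 'I_L}).
Implicit Types z t : {perm 'I_L}.

Definition incr_on z : bool :=
  [forall i in A, forall j in A, (i < j)%N ==> (z i < z j)%N].

Lemma incr_onP z : reflect (forall i j, i \in A -> j \in A -> (i < j)%N -> (z i < z j)%N)
  (incr_on z).
Proof.
apply: (iffP forall_inP) => [zA i j iA jA ij|zA i iA].
  by have /forall_inP/(_ j jA)/implyP := zA i iA; apply.
by apply/forall_inP => j jA; apply/implyP; apply: zA.
Qed.

(** A drop [t i < i] inside [A] would give [t (t i) < t i], and so an infinite descent. *)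
Lemma incr_perm_on t : perm_on A t ->
  (forall i j, i \in A -> j \in A -> (i < j)%N -> (t i < t j)%N) -> t = 1%g.
Proof.
move=> tA incr; apply: invg_inj; rewrite invg1; apply: perm_of_le => j.
rewrite -{2}(permKV t j); move: ((t^-1)%g j) => {j}i.
have [iA|iA] := boolP (i \in A); last by rewrite (out_perm tA).
rewrite leqNgt; apply/negP; elim/ltn_ind: {i}(i : nat) {-2}i (erefl (i : nat)) iA => m IH i im iA ti.
have tiA : t i \in A by rewrite perm_closed.
by apply: (IH (t i) _ (t i) erefl tiA); [rewrite -im | apply: incr].
Qed.

(* Among the rearrangements of z along A, one maximizing sum_k k z(k) is
   increasing on A. *)
Lemma incr_on_exists z : exists2 t, perm_on A t & incr_on (t * z)%g.
Proof.
pose w t := (\sum_(k < L) k * (t * z)%g k)%N.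
have p1 : perm_on A (1%g : {perm 'I_L}) by apply: perm_on1.
case: (@arg_maxnP _ 1%g (perm_on A) w p1) => t tA tmax.
exists t => //; apply/incr_onP => i j iA jA ij; rewrite ltnNge; apply/negP => le_ji.
have lt_ji : ((t * z)%g j < (t * z)%g i)%N.
  rewrite ltn_neqAle le_ji andbT (inj_eq val_inj) (inj_eq perm_inj).
  by apply: contraTneq ij => ->; rewrite ltnn.
have ijA : perm_on A (tperm i j).
  apply/fintype.subsetP => k; rewrite inE; case: tpermP => [->|->|] //; by rewrite eqxx.
have := tmax _ (perm_onM ijA tA); apply/negP; rewrite -ltnNge /w.
have nji : j != i by rewrite -val_eqE /= gtn_eqF.
rewrite (bigD1 i) //= (bigD1 j) //= [X in (_ < X)%N](bigD1 i) //= [X in (_ < _ + X)%N](bigD1 j) //=.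
rewrite !addnA -mulgA !permM tpermL tpermR -!permM.
rewrite [X in (_ < _ + X)%N](eq_bigr (fun k : 'I_L => k * (t * z)%g k)%N) => [|k /andP[ki kj]].
  rewrite ltn_add2r; move: ij lt_ji; move: ((t * z)%g i : nat) ((t * z)%g j : nat) => a b.
  by nia.
by rewrite permM tpermD // eq_sym.
Qed.

(** Every permutation is, in exactly one way, a permutation of [A] followed by one that increases on
    [A]. *)
Lemma card_incr_on : (#|incr_on| * (#|A|)`! = L`!)%N.
Proof.
rewrite -card_perm -cardX -[RHS]card_Sn.
pose f (zt : {perm 'I_L} * {perm 'I_L}) := (zt.2 * zt.1)%g.
have f_inj : {in [predX incr_on & perm_on A] &, injective f}.
  move=> [z t] [z' t']; rewrite !inE /= /f /= => /andP[/incr_onP zA tA] /andP[/incr_onP zA' tA'] E.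
  have zE : z' = (t'^-1 * t * z)%g by rewrite -mulgA E mulKg.
  have rA : perm_on A (t'^-1 * t)%g by apply: perm_onM => //; rewrite perm_onV.
  have r1 : (t'^-1 * t)%g = 1%g.
    apply: incr_perm_on => // i j iA jA ij; have := zA' i j iA jA ij; rewrite zE ![(_ * z)%g _]permM.
    have := @perm_closed _ _ _ i rA; have := @perm_closed _ _ _ j rA; rewrite iA jA.
    move: ((t'^-1 * t)%g i) ((t'^-1 * t)%g j) => a b bA aA.
    by case: (ltngtP a b) => // [/(zA _ _ bA aA)|/val_inj->]; lia.
  by rewrite zE r1 mul1g; congr (_, _); apply/eqP; rewrite eq_sym eq_mulVg1 r1.
rewrite -(card_in_image f_inj); apply: eq_card => y; rewrite [RHS]inE.
have [t tA yA] := incr_on_exists y; apply/fintype.imageP; exists ((t * y)%g, (t^-1)%g).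
  have tA' : perm_on A (t^-1)%g by apply: perm_onV.
  by rewrite !inE /=; apply/andP.
by rewrite /f /= mulKg.
Qed.

End IncreasingPermutations.

(** * Counting signed permutations with a marked set *)

Section Codes.
Variable l : nat.
Local Notation L := l.+1.

(** A signed permutation with absolute values [z] and signs [e], [true] meaning minus, and a set [A]
    of positive indices. In [valid_code], [ord_max] stands for the middle index and the last
    condition for [normalized]. *)
Definition code := ({perm 'I_L} * {ffun 'I_L -> bool} * {set 'I_L})%type.

Definition valid_code (c : code) : bool :=
  let: (z, e, A) := c in
  [&& ord_max \in A, incr_on A z, [forall a in A, (a != ord_max) ==> e a] &
      ~~ e ((z^-1)%g ord_max)].

(** The signs are forced at [x] and on [A] without [ord_max]. As [z] increases on [A], [x] can lie
    in [A] only as [ord_max], so exactly [#|A|] signs are forced. *)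
Lemma card_signs (z : {perm 'I_L}) (A : {set 'I_L}) : ord_max \in A -> incr_on A z ->
  #|[pred e : {ffun 'I_L -> bool} | [forall a in A, (a != ord_max) ==> e a]
      & ~~ e ((z^-1)%g ord_max)]| = (2 ^ (L - #|A|))%N.
Proof.
move=> maxA /incr_onP zA; set x := ((z^-1)%g ord_max).
have zx : z x = ord_max by rewrite /x permKV.
have xA : (x \in A) -> x = ord_max.
  move=> xA; apply/eqP/negPn/negP => xmax.
  have := zA x ord_max xA maxA; rewrite zx ltn_neqAle xmax leq_ord => /(_ isT) /=.
  by have := ltn_ord (z ord_max); lia.
pose F (a : 'I_L) : pred bool :=
  if a == x then pred1 false else if (a \in A) && (a != ord_max) then pred1 true else predT.
rewrite (@eq_card _ _ (family F)); last first.
  move=> e; rewrite !inE; apply/andP/familyP => [[/forall_inP eA ex] a|eF].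
    rewrite /F; case: eqP => [->|_]; first by rewrite inE; apply/eqP/negbTE.
    by case: ifP => // /andP[aA am]; rewrite inE; have /implyP/(_ am)-> := eA a aA.
  split; last by have := eF x; rewrite /F eqxx inE => /eqP->.
  apply/forall_inP => a aA; apply/implyP => am; have := eF a; rewrite /F aA am.
  case: eqP => [ax|_]; last by rewrite inE => /eqP.
  by move: am; rewrite ax (xA _) ?eqxx // -ax.
rewrite card_family foldrE big_image /=.
pose free := ~: (x |: (A :\ ord_max)).
have -> : (\prod_(a : 'I_L) #|F a| = \prod_(a in free) 2)%N.
  rewrite [RHS]big_mkcond; apply: eq_bigr => a _; rewrite /free !inE /F.
  case: eqP => _ /=; first by rewrite card1.
  rewrite [(a \in A) && _]andbC; case: (_ && _) => /=; first by rewrite card1.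
  exact: card_bool.
rewrite prod_nat_const cardsCs finset.setCK card_ord cardsU1 !inE (cardsD1 ord_max A) maxA.
have -> : (x != ord_max) && (x \in A) = false.
  by apply/negP => /andP[xm /xA xE]; rewrite xE eqxx in xm.
by [].
Qed.

Lemma card_valid_code : #|valid_code| =
  (\sum_(A : {set 'I_L} | ord_max \in A) L`! %/ (#|A|)`! * 2 ^ (L - #|A|))%N.
Proof.
pose F c : nat := if valid_code c then 1 else 0.
have -> : #|valid_code| = (\sum_(A : {set 'I_L}) \sum_z \sum_e F (z, e, A))%N.
  rewrite -sum1_card big_mkcond /= [RHS]exchange_big /=.
  under [RHS]eq_bigr => z _ do rewrite exchange_big /=.
  by rewrite !pair_bigA; apply: eq_bigr => -[[z e] A] _.
rewrite [RHS]big_mkcond; apply: eq_bigr => A _; case: ifP => maxA; last first.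
  by rewrite big1 // => z _; rewrite big1 // => e _; rewrite /F /= maxA.
have -> : (L`! %/ (#|A|)`! = #|incr_on A|)%N by rewrite -(card_incr_on A) mulnK // fact_gt0.
rewrite -(sum1_card (incr_on A)) big_distrl /= [RHS]big_mkcond; apply: eq_bigr => z _.
have -> : (z \in incr_on A) = incr_on A z by [].
have [zA|zA] := boolP (incr_on A z); last first.
  rewrite big1 // => e _.
  by rewrite /F /= (negPf zA) andbF.
rewrite mul1n -(card_signs maxA zA) -sum1_card [RHS]big_mkcond.
by apply: eq_bigr => e _; rewrite /F /= maxA zA.
Qed.

(** A set of [k] elements containing [ord_max] amounts to [k - 1] of the other [l] elements; [k = 0]
    does not occur. *)
Lemma sum_by_card (f : nat -> nat) :
  (\sum_(A : {set 'I_L} | ord_max \in A) f #|A| = \sum_(1 <= k < L.+1) 'C(l, k.-1) * f k)%N.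
Proof.
rewrite (partition_big (fun A : {set 'I_L} => inord #|A| : 'I_L.+1) predT) //=.
rewrite big_add1 big_mkord big_ord_recl big_pred0 ?add0n => [|A]; last first.
  have cA : (#|A| <= L)%N by rewrite -[X in (_ <= X)%N](card_ord L) max_card.
  rewrite -val_eqE /= inordK // cards_eq0; apply/negP => /andP[maxA /eqP A0].
  by rewrite A0 inE in maxA.
apply: eq_bigr => k _ /=.
transitivity (\sum_(A : {set 'I_L} | (ord_max \in A) && (#|A| == k.+1)) f k.+1)%N.
  apply: eq_big => [A|A /andP[_ /eqP E]].
    have cA : (#|A| <= L)%N by rewrite -[X in (_ <= X)%N](card_ord L) max_card.
    by rewrite -val_eqE /= inordK.
  have cA : (#|A| <= L)%N by rewrite -[X in (_ <= X)%N](card_ord L) max_card.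
  by move: E => /(congr1 val); rewrite /= inordK // => ->.
rewrite sum_nat_const; congr (_ * _)%N.
have -> : 'C(l, k) = #|[set B : {set 'I_L} | (B \subset ~: [set ord_max]) & (#|B| == k)]%SET|.
  by rewrite cards_draws cardsC1 card_ord.
have nmax (B : {set 'I_L}) : (B \subset ~: [set ord_max]) = (ord_max \notin B).
  by rewrite finset.subsetC finset.sub1set inE.
rewrite -[RHS](card_in_imset (f := fun B : {set 'I_L} => ord_max |: B)) => [|B B']; last first.
  rewrite !inE !nmax => /andP[mB _] /andP[mB' _] E.
  by rewrite -(setU1K mB) -(setU1K mB') E.
apply: eq_card => A; apply/idP/imsetP => [/andP[mA /eqP cA]|[B]].
  exists (A :\ ord_max); last by rewrite finset.setD1K.
  rewrite inE nmax finset.setD11 /=.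
  by move: cA; rewrite (cardsD1 ord_max A) mA add1n => -[->].
rewrite inE nmax => /andP[mB /eqP cB] ->.
by apply/andP; rewrite !inE eqxx cardsU1 mB cB.
Qed.

Lemma card_valid_code_lah :
  #|valid_code| = (\sum_(1 <= k < L.+1) 2 ^ (L - k) * lah L k)%N.
Proof.
rewrite card_valid_code (sum_by_card (fun k => L`! %/ k`! * 2 ^ (L - k))%N).
by apply: eq_bigr => k _; rewrite /lah /= mulnCA mulnC -mulnA [('C(_, _) * _)%N]mulnC mulnA.
Qed.

End Codes.

(** * Bijection between codes and valid orbit data *)

Section Decoding.
Variable l : nat.
Local Notation L := l.+1.
Local Notation n := (2 * L)%N.

(* Indices of e_1, ..., e_L, e_{-L}, ..., e_{-1} as an absolute value together
   with a sign, true meaning negative. *)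
Definition index_abs (i : 'I_n) : 'I_L := inord (if (i <= l)%N then i : nat else rev_ord i).
Definition index_sign (i : 'I_n) : bool := (l < i)%N.

Fact pos_index_proof (a : 'I_L) : (a < n)%N. Proof. by have := ltn_ord a; lia. Qed.
Definition pos_index a : 'I_n := Ordinal (pos_index_proof a).
Definition signed_index (a : 'I_L) (e : bool) : 'I_n :=
  if e then rev_ord (pos_index a) else pos_index a.

Lemma signed_indexK i : signed_index (index_abs i) (index_sign i) = i.
Proof.
apply: val_inj; rewrite /signed_index /index_sign /index_abs; have := ltn_ord i.
by case: (leqP i l) => il /= i_lt; rewrite inordK /=; lia.
Qed.

Lemma index_absK a e : index_abs (signed_index a e) = a.
Proof.
apply: val_inj; rewrite /index_abs /signed_index; have := ltn_ord a.
by case: e => /= al; case: ifP => il; rewrite inordK /=; lia.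
Qed.

Lemma index_signK a e : index_sign (signed_index a e) = e.
Proof. by rewrite /index_sign /signed_index; have := ltn_ord a; case: e => /=; lia. Qed.

Lemma signed_index_rev a e : rev_ord (signed_index a e) = signed_index a (~~ e).
Proof. by case: e; rewrite /signed_index /= ?rev_ordK. Qed.

Lemma index_sign_rev i : index_sign (rev_ord i) = ~~ index_sign i.
Proof. by rewrite -{1}(signed_indexK i) signed_index_rev index_signK. Qed.

Lemma mid1E : mid1 = signed_index ord_max false.
Proof. exact: val_inj. Qed.

Lemma mid2_signed : mid2 = signed_index ord_max true.
Proof. by rewrite /mid2 mid1E signed_index_rev. Qed.

Definition decode_fun (z : {perm 'I_L}) (e : {ffun 'I_L -> bool}) (i : 'I_n) : 'I_n :=
  signed_index (z (index_abs i)) (e (index_abs i) (+) index_sign i).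

Lemma decode_fun_inj z e : injective (decode_fun z e).
Proof.
move=> i j E; have absE : index_abs i = index_abs j.
  by have := congr1 index_abs E; rewrite !index_absK => /perm_inj.
have := congr1 index_sign E; rewrite !index_signK absE => /addbI signE.
by rewrite -(signed_indexK i) -(signed_indexK j) absE signE.
Qed.

(** An admissible set contains [mid2] and otherwise lies in the first half, so a set of positive
    indices encodes it. *)
Definition decode (c : code l) : datum l :=
  (perm (@decode_fun_inj c.1.1 c.1.2), mid2 |: [set pos_index a | a in c.2]).

Lemma decodeE z e A a b :
  (decode (z, e, A)).1 (signed_index a b) = signed_index (z a) (e a (+) b).
Proof. by rewrite permE /decode_fun index_absK index_signK. Qed.

Lemma pos_index_inj : injective pos_index.
Proof. by move=> a b /(congr1 val) /= ab; apply: val_inj. Qed.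

Lemma pos_index_decode z e A a : (pos_index a \in (decode (z, e, A)).2) = (a \in A).
Proof.
rewrite !inE mem_imset; last exact: pos_index_inj.
suff -> : pos_index a == mid2 = false by [].
by rewrite -val_eqE /=; have := ltn_ord a; lia.
Qed.

Lemma decode_inj : injective decode.
Proof.
move=> [[z e] A] [[z' e'] A'] E.
have sE a : signed_index (z a) (e a (+) false) = signed_index (z' a) (e' a (+) false).
  by rewrite -(decodeE z e A) -(decodeE z' e' A') E.
congr (_, _, _).
- by apply/permP => a; have := congr1 index_abs (sE a); rewrite !index_absK.
- by apply/ffunP => a; have := congr1 index_sign (sE a); rewrite !index_signK !addbF.
- by apply/finset.setP => a; rewrite -(pos_index_decode z e) E pos_index_decode.
Qed.

Lemma signed_index_lt a b e : (signed_index a e < signed_index b true)%N =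
  if e then (b < a)%N else true.
Proof. by have := ltn_ord a; have := ltn_ord b; case: e => /=; lia. Qed.

(** The sign at [z^-1 ord_max] decides [normalized], membership of [ord_max] decides [admissible],
    and the antichain condition splits into the signs on [A] and the monotonicity of [z]. *)
Lemma valid_decode c : valid (decode c) = valid_code c.
Proof.
case: c => [[z e] A]; set d := decode _.
have dE a b : d.1 (signed_index a b) = signed_index (z a) (e a (+) b) by apply: decodeE.
have rd : rev_comm d.1.
  move=> i; rewrite -(signed_indexK i) signed_index_rev !dE signed_index_rev.
  by rewrite addbN.
have normE : normalized d.1 = ~~ e ((z^-1)%g ord_max).
  have d1 : (d.1^-1)%g mid1 = signed_index ((z^-1)%g ord_max) (e ((z^-1)%g ord_max)).
    by apply: (@perm_inj _ d.1); rewrite permKV dE permKV addbb mid1E.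
  rewrite /normalized (rev_commV rd) d1 signed_index_rev.
  have := ltn_ord ((z^-1)%g ord_max); by case: (e _) => /=; lia.
have memT i : (i \in d.2) = (i == mid2) || (~~ index_sign i && (index_abs i \in A)).
  have [->|i2] := eqVneq i mid2; first by rewrite !inE eqxx.
  case: (boolP (index_sign i)) => [si|si]; last first.
    by rewrite -{1}(signed_indexK i) (negPf si); apply: pos_index_decode.
  rewrite !inE (negPf i2) /=; apply/negP => /imsetP[a _ E].
  by move: si; rewrite E -[pos_index a]/(signed_index a false) index_signK.
have admE : admissible d.2 = (ord_max \in A).
  apply/admissibleP/idP => [[]|maxA].
    by rewrite mid1E memT index_signK index_absK mid2_signed => /orP[/eqP/(congr1 index_sign)|//]; rewrite !index_signK.
  split; first by rewrite mid1E memT index_signK index_absK maxA orbT.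
    by rewrite memT eqxx.
  move=> i; rewrite memT => /orP[/eqP->|/andP[+ _]]; first by rewrite mid2E.
  by rewrite /index_sign; lia.
rewrite /valid normE admE /=.
have -> : [forall i, d.1 (rev_ord i) == rev_ord (d.1 i)].
  by apply/forallP => i; rewrite rd.
rewrite /= andbCA; case: (boolP (ord_max \in A)) => //= maxA.
rewrite [RHS]andbA andbC; congr (_ && _).
have Tpos a : a \in A -> signed_index a false \in d.2.
  by move=> aA; rewrite memT index_signK index_absK aA orbT.
have T2 : signed_index ord_max true \in d.2 by rewrite memT mid2_signed eqxx.
have rev_pos a b : signed_index b false != rev_ord (signed_index a false).
  by rewrite signed_index_rev; apply/eqP => /(congr1 index_sign); rewrite !index_signK.
apply/antichainP/andP => [anti|[/incr_onP zA /forall_inP eA] i j iT jT ij ji].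
  have lt_max a : a \in A -> a != ord_max -> (a < l)%N.
    by move=> _; rewrite -val_eqE /=; have := ltn_ord a; lia.
  (* The image of [a] comes after the images of both middle positions, which are opposite to each
     other. It is therefore negative and of smaller absolute value. *)
  have eA a : a \in A -> a != ord_max -> e a /\ (z a < z ord_max)%N.
    move=> aA am; have al := lt_max a aA am.
    have lt1 := anti _ _ (Tpos _ aA) (Tpos _ maxA) al (rev_pos _ _).
    have lt2 : (d.1 (signed_index ord_max true) < d.1 (signed_index a false))%N.
      apply: anti => //; first exact: Tpos.
        by rewrite /=; lia.
      rewrite signed_index_rev; apply/eqP => /(congr1 index_abs); rewrite !index_absK => E.
      by rewrite E eqxx in am.
    move: lt1 lt2; rewrite !dE !addbF addbT; have := ltn_ord (z a); have := ltn_ord (z ord_max).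
    by case: (e a); case: (e ord_max) => /=; lia.
  split; last by apply/forall_inP => a aA; apply/implyP => /(eA a aA)[].
  apply/incr_onP => a b aA bA ab.
  have am : a != ord_max by rewrite -val_eqE /=; have := ltn_ord b; lia.
  have [ea zam] := eA a aA am.
  have [->//|bm] := eqVneq b ord_max.
  have [eb _] := eA b bA bm.
  have := anti _ _ (Tpos _ aA) (Tpos _ bA) ab (rev_pos _ _).
  by rewrite !dE ea eb signed_index_lt.
move: iT; rewrite memT => /orP[/eqP i2|/andP[si iA]].
  move: jT; rewrite memT => /orP[/eqP j2|/andP[sj _]]; first by move: ij; rewrite i2 j2 ltnn.
  by move: ij sj; rewrite i2 mid2E /index_sign; lia.
have iE : i = signed_index (index_abs i) false by rewrite -{1}(signed_indexK i) (negPf si).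
set a := index_abs i in iE iA.
have [am ea] : a != ord_max /\ e a.
  have am : a != ord_max.
    apply/eqP => am; move: jT ij; rewrite memT iE am => /orP[/eqP jE|/andP[sj _]].
      by move: ji; rewrite iE am jE signed_index_rev mid2_signed eqxx.
    by move: sj; rewrite /index_sign /=; lia.
  by split=> //; have /implyP/(_ am) := eA a iA.
have ltam : (z a < z ord_max)%N.
  by apply: zA => //; move: am; rewrite -val_eqE /=; have := ltn_ord a; lia.
rewrite iE dE ea /=; move: jT; rewrite memT => /orP[/eqP->|/andP[sj jA]].
  by rewrite mid2_signed dE signed_index_lt; case: ifP.
have jE : j = signed_index (index_abs j) false by rewrite -{1}(signed_indexK j) (negPf sj).
rewrite jE dE signed_index_lt; case: ifP => // _.
by apply: zA => //; move: ij; rewrite {1}iE {1}jE.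
Qed.

Lemma decode_surj d : valid d -> exists c, decode c = d.
Proof.
case: d => s T /validP[/= rs _ /admissibleP[T1 T2 leT] _].
have s_abs (i j : 'I_n) : index_abs i = index_abs j -> i = j \/ i = rev_ord j.
  move=> absE; rewrite -(signed_indexK i) -(signed_indexK j) absE signed_index_rev.
  by case: (index_sign i); case: (index_sign j); [left|right|right|left].
have z_inj : injective (fun a => index_abs (s (pos_index a))).
  move=> a b /s_abs[/perm_inj/pos_index_inj //|].
  rewrite -rs => /perm_inj/(congr1 index_sign); rewrite index_sign_rev.
  by rewrite -![pos_index _]/(signed_index _ false) !index_signK.
exists (perm z_inj, [ffun a => index_sign (s (pos_index a))], [set a | pos_index a \in T]%SET).
congr (_, _).
  apply/permP => i; rewrite -(signed_indexK i) decodeE permE ffunE.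
  move: (index_abs i) => a; case: (index_sign i); rewrite ?addbT ?addbF.
    by rewrite -signed_index_rev signed_indexK -rs.
  by rewrite signed_indexK.
apply/finset.setP => i; rewrite !inE.
have [->|i2] := eqVneq i mid2; first by rewrite T2.
apply/imsetP/idP => [[a]|iT]; first by rewrite inE => aT ->.
have si : index_sign i = false.
  by have := leT i iT; move: i2; rewrite -val_eqE /index_sign /=; lia.
have iE : i = pos_index (index_abs i) by rewrite -{1}(signed_indexK i) si.
by exists (index_abs i) => //; rewrite inE -iE.
Qed.

Lemma card_valid : #|@valid l| = (\sum_(1 <= k < L.+1) 2 ^ (L - k) * lah L k)%N.
Proof.
rewrite -card_valid_code_lah -(fintype.card_image decode_inj (@valid_code l)).
apply: eq_card => d; apply/idP/fintype.imageP => [vd|[c vc ->]]; last first.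
  by have : valid_code c := vc; rewrite -valid_decode.
have [c cE] := decode_surj vd.
have vc : valid_code c by rewrite -valid_decode cE.
by exists c.
Qed.

End Decoding.

(** * The orbit count in terms of Lah numbers *)

Lemma lah_rat l k : (1 <= k <= l)%N ->
  (lah l k)%:R = l`!%:R / k`!%:R * 'C(l.-1, k.-1)%:R :> rat.
Proof.
move=> /andP[k1 kl]; rewrite /lah natrM; congr (_ * _).
have dv : (k`! %| l`!)%N by rewrite -(bin_fact kl) mulnCA dvdn_mulr.
have k0 : k`!%:R != 0 :> rat by rewrite pnatr_eq0 -lt0n fact_gt0.
by apply: (mulIf k0); rewrite divfK // -natrM divnK.
Qed.

Theorem proposition3p14 (R : realType) (l : nat) (hl : (1 <= l)%N) :
  (orbit_set (@B_SO_odd R[i] l) (@flag_variety_so R[i] l)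
     #= `I_(\sum_(1 <= k < l.+1) 2 ^ (l - k) * lah l k)%N)%card
  /\ ((\sum_(1 <= k < l.+1) 2 ^ (l - k) * lah l k)%N%:R
      = \sum_(1 <= k < l.+1)
          2 ^+ (l - k) * (l`!%:R / k`!%:R) * 'C(l.-1, k.-1)%:R :> rat).
Proof.
split.
  (* The orbits were counted for rank [l.+1], which covers every [l >= 1]. *)
  by case: l hl => // l _; rewrite -card_valid; apply: orbit_set_card.
rewrite natr_sum; apply: eq_big_nat => k kl.
by rewrite natrM natrX (lah_rat kl); apply: mulrA.
Qed.
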